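(* Let $\sigma:\mathbb R\to\mathbb R$ be four times continuously differentiable with bounded derivatives of orders $1,2,3,4$. Fix an $\ell$-layer neural network with activation $\sigma$, i.e. layer maps $g^k(x)=\sigma(A^kx+b^k)+C^kx+d^k$, $k=1,\dots,\ell$. For each $\lambda>0$ let $X=X_\lambda$ be a Gaussian random vector in the input space, with covariance $\operatorname{Cov}X_\lambda=O(\lambda^{-2})$ as $\lambda\to\infty$. Let $Y^k_{\mathrm{true}}$ and $Y^k$ be the true and the moment-matched distributions at layer $k$ for the input $X_\lambda$. Then for every $k\in\{1,\dots,\ell\}$, $$d_4(Y^k_{\mathrm{true}},Y^k)=O(\lambda^{-4})\qquad(\lambda\to\infty).$$
   Context: Layers: $n_0,\dots,n_\ell$ are positive integers; $A^k,C^k\in\mathbb R^{n_k\times n_{k-1}}$, $b^k,d^k\in\mathbb R^{n_k}$ are fixed parameters; $\sigma$ is applied elementwise, so $g^k:\mathbb R^{n_{k-1}}\to\mathbb R^{n_k}$. The input $X$ takes values in $\mathbb R^{n_0}$. For a square-integrable random vector $U$, $\mathrm N U$ denotes a random vector with law $\mathcal N(\mathbb E U,\operatorname{Cov}U)$. The true layer variables are $Y^0_{\mathrm{true}}=X$, $Y^k_{\mathrm{true}}=g^k(Y^{k-1}_{\mathrm{true}})$ for $1\le k\le\ell$. The moment-matched layer variables are $Y^0=X$, $Y^k=\mathrm N\,g^k(Y^{k-1})$ for $1\le k\le\ell$ (only their laws matter). For a four times continuously differentiable $h:\mathbb R^d\to\mathbb R$ define $\|h\|_{\dot W^{4,\infty}}:=\max_{1\le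 j\le 4}\sup_{x\in\mathbb R^d}\|D^jh(x)\|_{\mathrm{op}}$, where $D^jh(x)$ is the $j$-th derivative viewed as a $j$-linear form and $\|\cdot\|_{\mathrm{op}}$ is its operator norm. For random variables $U,V$ with values in $\mathbb R^d$, $$d_4(U,V):=\sup_{\|h\|_{\dot W^{4,\infty}}\le 1}\big|\mathbb E h(U)-\mathbb E h(V)\big|.$$ *)

(* Defs.v *)
From HB Require Import structures.
From mathcomp Require Import all_boot all_order all_algebra.
From mathcomp Require Import all_classical all_reals all_analysis.
Set Implicit Arguments.
Unset Strict Implicit.
Unset Printing Implicit Defensive.
Import Order.TTheory GRing.Theory Num.Theory.
Import numFieldNormedType.Exports.

Local Open Scope ring_scope.
Local Open Scope classical_set_scope.

Section Smoothness.
Context {R : realType}.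

(* The library norm on matrices is the max norm; operator norms of derivatives
   are taken with respect to the Euclidean norm. *)
Definition l2norm n (x : 'cV[R]_n) : R := Num.sqrt (\sum_i x i 0 ^+ 2).

(* D^j h(x)(v_1, ..., v_j) for vs = [:: v_1; ...; v_j], as the iterated Frechet
   differential: D^j h(x)(v_1, ..., v_j) = D[y |-> D^(j-1) h(y)(v_2, ..., v_j)](x)(v_1). *)
Fixpoint iterdiff n (h : 'cV[R]_n -> R) (vs : seq 'cV[R]_n) : 'cV[R]_n -> R :=
  if vs is v :: vs' then fun x => 'd (iterdiff h vs') x v else h.

(* The space of multilinear forms being finite dimensional, h is of class C^m
   iff every evaluation of D^j h (j < m) is differentiable and every
   evaluation of D^m h is continuous. *)
Definition classC (m : nat) n (h : 'cV[R]_n -> R) : Prop :=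
  (forall vs, (size vs < m)%N -> forall x, differentiable (iterdiff h vs) x) /\
  (forall vs, size vs = m -> continuous (iterdiff h vs)).

Definition multilinear_opnorm j n (L : j.-tuple 'cV[R]_n -> R) : \bar R :=
  ereal_sup [set (`|L vs|)%:E | vs in
    [set vs : j.-tuple 'cV[R]_n | forall i, l2norm (tnth vs i) <= 1]].

Definition W4norm n (h : 'cV[R]_n -> R) : \bar R :=
  \big[maxe/-oo%E]_(1 <= j < 5)
    ereal_sup [set multilinear_opnorm (fun vs : j.-tuple 'cV[R]_n => iterdiff h vs x)
              | x in [set: 'cV[R]_n]].

Definition activation_C4b (sigma : R -> R) : Prop :=
  [/\ forall j x, (j < 4)%N -> derivable (sigma^`(j)) x 1,
      continuous (sigma^`(4)) &
      exists M : R, forall j x, (1 <= j <= 4)%N -> `|sigma^`(j) x| <= M].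

End Smoothness.

Section RandomVectors.
Context {R : realType}.

(* 'cV[R]_n has no measurable structure in the library; Borel measurability of a
   vector-valued map is measurability of its coordinates. *)
Definition measurable_vec d (T : measurableType d) n (U : T -> 'cV[R]_n) : Prop :=
  forall i, measurable_fun [set: T] (fun w => U w i 0).

(* fine is harmless on square-integrable vectors, the only ones it is used for. *)
Definition mean_vec d (T : measurableType d) (P : probability T R) n
    (U : T -> 'cV[R]_n) : 'cV[R]_n :=
  \col_i fine (expectation P (fun w => U w i 0)).

Definition cov_mx d (T : measurableType d) (P : probability T R) n
    (U : T -> 'cV[R]_n) : 'M[R]_n :=
  \matrix_(i, j) fine (covariance P (fun w => U w i 0) (fun w => U w j 0)).

(* N(m, v) on R with variance v >= 0. The library's normal_prob takes the standard
   deviation, and normal_prob m 0 is the uniform law on [0, 1], not the Dirac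
   mass at m. *)
Definition normal_law1 (m v : R) (B : set R) : \bar R :=
  if v == 0 then \d_m B else normal_prob m (Num.sqrt v) B.

(* U has law N(m, S), S possibly singular: every linear functional t^T U has law
   N(t^T m, t^T S t). *)
Definition has_normal_law d (T : measurableType d) (P : probability T R) n
    (U : T -> 'cV[R]_n) (m : 'cV[R]_n) (S : 'M[R]_n) : Prop :=
  [/\ measurable_vec U,
      S^T = S &
      forall t : 'cV[R]_n, 0 <= (t^T *m S *m t) 0 0 /\
        forall B : set R, measurable B ->
          P [set w | B ((t^T *m U w) 0 0)] =
          normal_law1 ((t^T *m m) 0 0) ((t^T *m S *m t) 0 0) B].

Definition gaussian_vec d (T : measurableType d) (P : probability T R) n
    (U : T -> 'cV[R]_n) : Prop :=
  exists m S, has_normal_law P U m S.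

(* V (under Q) is a version of N U (U under P). *)
Definition moment_matched d d' (T : measurableType d) (T' : measurableType d')
    (P : probability T R) (Q : probability T' R) n
    (U : T -> 'cV[R]_n) (V : T' -> 'cV[R]_n) : Prop :=
  has_normal_law Q V (mean_vec P U) (cov_mx P U).

Definition d4 d d' (T : measurableType d) (T' : measurableType d')
    (P : probability T R) (Q : probability T' R) n
    (U : T -> 'cV[R]_n) (V : T' -> 'cV[R]_n) : \bar R :=
  ereal_sup [set (`|'E_P[h \o U] - 'E_Q[h \o V]|)%E | h in
    [set h : 'cV[R]_n -> R | classC 4 h /\ (W4norm h <= 1)%E]].

End RandomVectors.

Section Network.
Context {R : realType}.

Definition layer (sigma : R -> R) p q (A : 'M[R]_(q, p)) (b : 'cV[R]_q)
    (C : 'M[R]_(q, p)) (c : 'cV[R]_q) (x : 'cV[R]_p) : 'cV[R]_q :=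
  map_mx sigma (A *m x + b) + C *m x + c.

(* g^k o ... o g^1, with g k : R^(n_(k-1)) -> R^(n_k); g 0 is never used. *)
Fixpoint forward (n : nat -> nat)
    (g : forall k, 'cV[R]_(n k.-1) -> 'cV[R]_(n k)) (k : nat) :
    'cV[R]_(n 0%N) -> 'cV[R]_(n k) :=
  match k with
  | 0%N => id
  | k'.+1 => g k'.+1 \o forward g k'
  end.

End Network.

(* Main.v *)
(* The error is split layer by layer. Replacing the input of layer k by its
   moment-matched version costs a bounded multiple of the error at layer k - 1,
   since the test functions with bounded derivatives of orders 1 to 4 are stable,
   up to constants, under composition with a layer. The remaining error is that
   of one Gaussian approximation: if U is normal with covariance O(delta^2) then
   G = g(U) and its moment-matched V share mean m and covariance O(delta^2), so
   in the Taylor expansion of h at m the terms of order at most 2 agree and the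
   remainders are O(delta^4). The third moment of V - m vanishes; that of G - m is
   O(delta^4), since its leading part is a cubic form in U - E U, whose mean is 0
   by symmetry. *)
Require Import Defs.
From HB Require Import structures.
From mathcomp Require Import all_boot all_order all_algebra.
From mathcomp Require Import all_classical all_reals all_analysis.
From mathcomp Require Import measurable_realfun ring lra.
Import Order.TTheory GRing.Theory Num.Theory.
Import numFieldNormedType.Exports.
Local Open Scope ring_scope.
Local Open Scope classical_set_scope.

Set Implicit Arguments.
Unset Strict Implicit.

(** * Functions with bounded partial derivatives *)

Section BoundedDerivatives.
Context {R : realType}.

(** Three obstacles shape the proof. The estimate concerns a supremum over test functions and must
    hold for all large [lambda], so every constant is chosen before the test function, the
    probability spaces and the random vectors; it depends only on dimensions, derivative bounds and
    the covariance constant. The normal law, possibly singular, is given through its linear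
    functionals alone, so moments are read off the one-dimensional moment generating function, and
    mixed moments come from polarization. Finally, random errors must be weighed against
    deterministic ones, such as the shift of E g(U) from g(E U): with [delta] = 1 / [lambda], the
    variable Z = |U - E U| + [delta] dominates both kinds, and E Z^k = O([delta]^k) for k <= 4 turns
    pointwise bounds by Z^k into bounds on expectations. *)

Definition pd n (i : 'I_n) (h : 'cV[R]_n -> R) : 'cV[R]_n -> R :=
  fun x => 'd h x (delta_mx i 0).

(** One bound [M] serves the partial derivatives of all orders from 0 to [m]. Only coordinate
    partials occur, so that sum, product and chain rules become inductions on [m]. *)
Fixpoint Cb m (M : R) n (h : 'cV[R]_n -> R) : Prop :=
  (forall x, `|h x| <= M) /\
  if m is m'.+1 then
    (forall x, differentiable h x) /\ (forall i, Cb m' M (pd i h))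
  else True.

(** Layers and test functions may be unbounded, so [h] itself is exempt. The bounded orders are 1 to
    [m] + 1; four derivatives correspond to [derivs_bounded 3]. *)
Definition derivs_bounded m (M : R) n (h : 'cV[R]_n -> R) : Prop :=
  (forall x, differentiable h x) /\ (forall i, Cb m M (pd i h)).

Lemma Cb_bound m M n (h : 'cV[R]_n -> R) x : Cb m M h -> `|h x| <= M.
Proof. by case: m => [|m] []. Qed.

Lemma Cb_ge0 m M n (h : 'cV[R]_n -> R) : Cb m M h -> 0 <= M.
Proof. by move=> /(@Cb_bound _ _ _ _ 0); exact: le_trans. Qed.

Lemma Cb_mono m M M' n (h : 'cV[R]_n -> R) : M <= M' -> Cb m M h -> Cb m M' h.
Proof.
move=> MM'; elim: m h => [|m IH] h /= [hM H]; split => //.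
- by move=> x; exact: le_trans MM'.
- by move=> x; exact: le_trans MM'.
- by case: H => dh H; split => // i; exact: IH.
Qed.

Lemma Cb_pred m M n (h : 'cV[R]_n -> R) : Cb m.+1 M h -> Cb m M h.
Proof.
elim: m h => [|m IH] h; first by case.
by move=> [hM [dh H]]; split=> //; split=> // i; exact: IH.
Qed.

Lemma pdD n (i : 'I_n) (f g : 'cV[R]_n -> R) :
  (forall x, differentiable f x) -> (forall x, differentiable g x) ->
  pd i (fun x => f x + g x) = fun x => pd i f x + pd i g x.
Proof.
move=> df dg; apply/funext => x; rewrite /pd.
have -> : (fun y => f y + g y) = f + g by exact/funext.
exact: (congr1 (@^~ (delta_mx i 0)) (diffD (df x) (dg x))).
Qed.

Lemma pdM n (i : 'I_n) (f g : 'cV[R]_n -> R) :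
  (forall x, differentiable f x) -> (forall x, differentiable g x) ->
  pd i (fun x => f x * g x) = fun x => f x * pd i g x + g x * pd i f x.
Proof.
move=> df dg; apply/funext => x; rewrite /pd.
have -> : (fun y => f y * g y) = f * g by exact/funext.
exact: (congr1 (@^~ (delta_mx i 0)) (diffM (df x) (dg x))).
Qed.

Lemma Cb_cst m n (a : R) : Cb m `|a| (fun _ : 'cV[R]_n => a).
Proof.
elim: m a => [//|m IH] a; split=> //; split; first exact: differentiable_cst.
move=> i; have -> : pd i (fun=> a) = fun=> 0.
  by apply/funext => x; rewrite /pd diff_cst.
by apply: (@Cb_mono _ `|0|); [rewrite normr0|exact: IH].
Qed.

Lemma CbD m M M' n (f g : 'cV[R]_n -> R) :
  Cb m M f -> Cb m M' g -> Cb m (M + M') (fun x => f x + g x).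
Proof.
elim: m f g => [|m IH] f g [fM Hf] [gM Hg].
  by split=> // x; rewrite (le_trans (ler_normD _ _))// lerD.
split; first by move=> x; rewrite (le_trans (ler_normD _ _))// lerD.
case: Hf => df Hf; case: Hg => dg Hg; split.
  by move=> x; exact: differentiableD.
by move=> i; rewrite (pdD _ df dg); exact: IH (Hf i) (Hg i).
Qed.

(** Each use of the Leibniz rule doubles the number of products, whence the factor 2^m. *)
Lemma CbM m M M' n (f g : 'cV[R]_n -> R) :
  Cb m M f -> Cb m M' g -> Cb m (2 ^+ m * (M * M')) (fun x => f x * g x).
Proof.
elim: m M M' f g => [|m IH] M M' f g.
  move=> [fM _] [gM _]; split => // x.
  by rewrite expr0 mul1r normrM ler_pM.
move=> Hf Hg; have M0 := Cb_ge0 Hf; have M'0 := Cb_ge0 Hg.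
have [fM [df pf]] := Hf; have [gM [dg pg]] := Hg; split.
  move=> x; rewrite normrM; apply: (@le_trans _ _ (M * M')).
    by rewrite ler_pM.
  by rewrite ler_peMl ?mulr_ge0// exprn_ege1// ler1n.
split; first by move=> x; exact: differentiableM.
move=> i; rewrite (pdM _ df dg) exprS -mulrA mulr_natl mulr2n {2}[M * M']mulrC.
apply: CbD.
  exact: IH (Cb_pred Hf) (pg i).
exact: IH (Cb_pred Hg) (pf i).
Qed.

Lemma Cb_sum m M n (I : Type) (r : seq I) (f : I -> 'cV[R]_n -> R) :
  (forall j, Cb m M (f j)) -> Cb m ((size r)%:R * M) (fun x => \sum_(j <- r) f j x).
Proof.
move=> Hf; elim: r => [|j r IH].
  rewrite mul0r; under eq_fun do rewrite big_nil.
  by rewrite -[X in Cb _ X](normr0 R); exact: Cb_cst.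
under eq_fun do rewrite big_cons.
by rewrite /= -natr1 mulrDl mul1r addrC; apply: CbD.
Qed.

Lemma col_sum_delta n (v : 'cV[R]_n) : v = \sum_i v i 0 *: delta_mx i 0.
Proof.
apply/matrixP => i k; rewrite ord1.
rewrite summxE (bigD1 i)//= !mxE !eqxx mulr1 big1 ?addr0// => j ji.
by rewrite !mxE eq_sym (negPf ji) mulr0.
Qed.

Lemma differentiable_vec p q (g : 'cV[R]_p -> 'cV[R]_q) x :
  (forall j, differentiable (fun y => g y j 0) x) -> differentiable g x.
Proof.
move=> dg.
have -> : g = \sum_(j < q) (fun y => g y j 0 *: (delta_mx j 0 : 'cV[R]_q)).
  by apply/funext => y; rewrite fct_sumE; exact: col_sum_delta.
apply: differentiable_sum => j; exact: differentiableZl.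
Qed.

Lemma diff_pd n (h : 'cV[R]_n -> R) x v :
  'd h x v = \sum_i v i 0 * pd i h x.
Proof.
rewrite {1}(col_sum_delta v) linear_sum; apply: eq_bigr => i _.
by rewrite linearZ.
Qed.

Lemma diff_coord p q (g : 'cV[R]_p -> 'cV[R]_q) x v j :
  differentiable g x -> ('d g x v) j 0 = 'd (fun y => g y j 0) x v.
Proof.
move=> dg; pose cj (y : 'cV[R]_q) := y j 0.
have lc : linear cj by move=> a y z; rewrite /cj !mxE.
pose L := GRing.isLinear.Build _ _ _ _ cj lc.
pose cL : {linear 'cV[R]_q -> R} := HB.pack cj L.
have cc : continuous cL by move=> y; exact: coord_continuous.
have dcL y : differentiable cL y by exact: differentiable_coord.
have -> : (fun y => g y j 0) = cL \o g by [].
by rewrite (diff_comp dg (dcL (g x))) /= (diff_lin _ cc).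
Qed.

Lemma pd_comp p q (f : 'cV[R]_q -> R) (g : 'cV[R]_p -> 'cV[R]_q) i :
  (forall y, differentiable f y) ->
  (forall j x, differentiable (fun y => g y j 0) x) ->
  pd i (f \o g) = fun x => \sum_j pd i (fun y => g y j 0) x * pd j f (g x).
Proof.
move=> df dg; apply/funext => x.
have dgx : differentiable g x by exact: differentiable_vec.
rewrite /pd diff_comp//= diff_pd; apply: eq_bigr => j _.
by rewrite diff_coord.
Qed.

(** A partial derivative of [f \o g] is a sum of products of partials of the coordinates of [g] with
    [pd j f \o g], to which the induction hypothesis applies. As [K] precedes [f] and [g], it serves
    all test functions at once. *)
Lemma Cb_comp m p q (L M : R) : exists K,
  forall (f : 'cV[R]_q -> R) (g : 'cV[R]_p -> 'cV[R]_q),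
    (forall j, derivs_bounded m L (fun y => g y j 0)) ->
    Cb m M f -> Cb m K (f \o g).
Proof.
elim: m => [|m [K IH]]; first by exists M => f g _ /= [fM _]; split => //=.
exists (Num.max M ((size (index_enum 'I_q))%:R * (2 ^+ m * (L * K)))) => f g Hg [fM [df Hf]].
have dg j x : differentiable (fun y => g y j 0) x by case: (Hg j).
split; first by move=> x; rewrite le_max fM.
split.
  move=> x; apply: differentiable_comp => //; exact: differentiable_vec.
move=> i; rewrite pd_comp//.
apply: (@Cb_mono _ ((size (index_enum 'I_q))%:R * (2 ^+ m * (L * K)))).
  by rewrite le_max lexx orbT.
apply: Cb_sum => j; apply: CbM; first by apply: Cb_pred; apply: (Hg j).2.
apply: (IH (pd j f) g); last exact: Hf.
move=> k; split; first exact: dg.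
by move=> l; apply: Cb_pred; apply: (Hg k).2.
Qed.

Lemma derivs_bounded_comp m p q (L M : R) : exists K,
  forall (f : 'cV[R]_q -> R) (g : 'cV[R]_p -> 'cV[R]_q),
    (forall j, derivs_bounded m L (fun y => g y j 0)) ->
    derivs_bounded m M f -> derivs_bounded m K (f \o g).
Proof.
have [K HK] := @Cb_comp m p q L M.
exists ((size (index_enum 'I_q))%:R * (2 ^+ m * (L * K))) => f g Hg [df Hf].
have dg j x : differentiable (fun y => g y j 0) x by case: (Hg j).
split.
  move=> x; apply: differentiable_comp => //; exact: differentiable_vec.
move=> i; rewrite pd_comp//.
apply: Cb_sum => j; apply: CbM; first exact: (Hg j).2.
apply: HK => //; exact: Hf.
Qed.

(** The hypothesis of the Taylor estimate: only derivatives of order exactly [m] enter the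
    remainder, and lower orders may be unbounded. *)
Fixpoint top_bounded m (M : R) n (h : 'cV[R]_n -> R) : Prop :=
  if m is m'.+1 then
    (forall x, differentiable h x) /\ (forall i, top_bounded m' M (pd i h))
  else forall x, `|h x| <= M.

Lemma Cb_top_bounded m k M n (h : 'cV[R]_n -> R) : (k <= m)%N ->
  Cb m M h -> top_bounded k M h.
Proof.
elim: k m h => [|k IH] m h km; first by move=> Hh x; exact: Cb_bound Hh.
case: m km => // m km [_ [dh H]]; split=> // i; exact: IH km (H i).
Qed.

Lemma derivs_bounded_top_bounded m k M n (h : 'cV[R]_n -> R) : (k <= m)%N ->
  derivs_bounded m M h -> top_bounded k.+1 M h.
Proof. by move=> km [dh H]; split=> // i; exact: Cb_top_bounded km (H i). Qed.

(* [dirderiv k h a y] is [D^k h(a)(y, ..., y)]. *)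
Fixpoint dirderiv k n (h : 'cV[R]_n -> R) (a y : 'cV[R]_n) : R :=
  if k is k'.+1 then \sum_i y i 0 * dirderiv k' (pd i h) a y else h a.

Definition taylor_poly m n (h : 'cV[R]_n -> R) (a y : 'cV[R]_n) : R :=
  \sum_(k < m) dirderiv k h a y / k`!%:R.

Lemma dirderivZ k n (h : 'cV[R]_n -> R) (a y : 'cV[R]_n) t :
  dirderiv k h a (t *: y) = t ^+ k * dirderiv k h a y.
Proof.
elim: k h => [|k IH] h /=; first by rewrite expr0 mul1r.
rewrite mulr_sumr; apply: eq_bigr => i _; rewrite IH mxE exprS; ring.
Qed.

Lemma is_derive_line n (h : 'cV[R]_n -> R) (a y : 'cV[R]_n) (t : R) :
  (forall x, differentiable h x) ->
  is_derive t 1 (fun t => h (a + t *: y)) (\sum_i y i 0 * pd i h (a + t *: y)).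
Proof.
move=> dh.
pose s (t : R) : 'cV[R]_n := t *: y.
have di : differentiable (id : R -> R) t by exact: ex_diff.
have ds : differentiable s t by exact: differentiableZl.
have dc : differentiable (cst a : R -> 'cV[R]_n) t by exact: differentiable_cst.
have dl := differentiableD dc ds.
have lv : 'd (cst a + s) t 1 = y.
  have E1 : 'd (cst a + s) t 1 = 'd (cst a : R -> _) t 1 + 'd s t 1.
    exact: (congr1 (@^~ 1) (diffD dc ds)).
  have E2 : 'd (cst a : R -> _) t 1 = 0.
    exact: (congr1 (@^~ 1) (diff_cst a t)).
  have E3 : 'd s t 1 = 'd (id : R -> R) t 1 *: y.
    exact: (congr1 (@^~ 1) (diffZl y di)).
  have E4 : 'd (id : R -> R) t 1 = 1 by rewrite diff_val.
  apply: (eq_trans E1); apply: (eq_trans (congr2 +%R E2 E3)).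
  by rewrite E4 add0r scale1r.
have dhl : differentiable (h \o (cst a + s)) t.
  exact: differentiable_comp dl (dh _).
rewrite (_ : (fun t => _) = h \o (cst a + s))//.
apply: DeriveDef; first exact/derivable1_diffP.
rewrite (deriveE _ dhl) (congr1 (@^~ 1) (diff_comp dl (dh _))) /= lv.
exact: diff_pd.
Qed.

Lemma norm_coord m n (A : 'M[R]_(m, n)) i j : `|A i j| <= `|A|.
Proof.
by rewrite [leRHS]/Num.Def.normr /= mx_normrE; apply: (le_bigmax _ _ (i, j)).
Qed.

Lemma taylor_poly0 m n (h : 'cV[R]_n -> R) (a : 'cV[R]_n) :
  taylor_poly m.+1 h a 0 = h a.
Proof.
rewrite /taylor_poly big_ord_recl /= fact0 divr1 big1 ?addr0// => i _.
by rewrite big1 ?mul0r// => j _; rewrite mxE mul0r.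
Qed.

(** Along the segment from [a] to [a + y], the derivative of the remainder of order [m] + 1 is the
    sum of y_i times the order [m] remainders of the [pd i h], so the mean value theorem and
    induction suffice. With the max norm, the sum over coordinates costs a factor [n] per order; the
    gain 1/m! is not kept. *)
Lemma taylor m M n (h : 'cV[R]_n -> R) (a y : 'cV[R]_n) : top_bounded m M h ->
  `|h (a + y) - taylor_poly m h a y| <= M * (n%:R * `|y|) ^+ m.
Proof.
elim: m h y => [|m IH] h y /=.
  by move=> hM; rewrite /taylor_poly big_ord0 subr0 expr0 mulr1.
move=> [dh Hh].
have [->|y0] := eqVneq y 0.
  by rewrite taylor_poly0 normr0 mulr0 expr0n mulr0 !addr0 subrr normr0.
pose p := \poly_(k < m.+1) (dirderiv k h a y / k`!%:R).
have pT t : p.[t] = taylor_poly m.+1 h a (t *: y).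
  rewrite horner_poly; apply: eq_bigr => k _; rewrite dirderivZ; ring.
pose dpsi t := \sum_i y i 0 *
  (pd i h (a + t *: y) - taylor_poly m (pd i h) a (t *: y)).
have dp t : (deriv p).[t] = \sum_i y i 0 * taylor_poly m (pd i h) a (t *: y).
  have -> : (deriv p) = \poly_(k < m) (dirderiv k.+1 h a y / k`!%:R).
    apply/polyP => k; rewrite coef_deriv !coef_poly ltnS.
    case: ltnP => // _; last by rewrite mul0rn.
    have k0 : k.+1%:R != 0 :> R by rewrite pnatr_eq0.
    by rewrite -[LHS]mulr_natl factS natrM invfM mulrCA mulVKf.
  rewrite horner_poly; under [RHS]eq_bigr do rewrite mulr_sumr.
  rewrite exchange_big; apply: eq_bigr => k _ /=.
  rewrite 2!mulr_suml; apply: eq_bigr => i _; rewrite dirderivZ; ring.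
have dps (t : R) : is_derive t 1 (fun t => h (a + t *: y) - p.[t]) (dpsi t).
  rewrite /dpsi; under eq_bigr do rewrite mulrBr.
  rewrite sumrB -dp; apply: is_deriveB; exact: is_derive_line.
have [|t t01] := @MVT_segment R (fun t => h (a + t *: y) - p.[t]) dpsi 0 1 ler01
    (fun t _ => dps t).
  apply: continuous_subspaceT => t; apply: differentiable_continuous.
  by apply/derivable1_diffP; exact: (@ex_derive _ _ _ _ _ _ _ (dps t)).
rewrite scale1r scale0r addr0 !pT scale1r scale0r.
rewrite taylor_poly0 subrr !subr0 mulr1 => ->.
move: t01; rewrite in_itv /= => /andP[t0 t1].
rewrite exprS mulrCA /dpsi.
apply: (le_trans (ler_norm_sum _ _ _)).
have -> : n%:R * `|y| * (M * (n%:R * `|y|) ^+ m) =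
    \sum_(i < n) `|y| * (M * (n%:R * `|y|) ^+ m).
  by rewrite sumr_const card_ord -[RHS]mulr_natl mulrA.
apply: ler_sum => i _; rewrite normrM ler_pM//; first exact: norm_coord.
apply: (le_trans (IH _ _ (Hh i))).
(* The index [i] is essential: in dimension 0 and positive order the hypothesis says nothing about
   [M]. *)
have M0 : 0 <= M.
  move: (pd i h) (Hh i); clear -i; elim: m => [|m IH] h.
    by move=> /(_ 0); exact: le_trans.
  by case=> _ /(_ i); exact: IH.
rewrite ler_wpM2l// lerXn2r ?nnegrE ?mulr_ge0//.
by rewrite ler_wpM2l// normrZ ger0_norm// ler_piMl.
Qed.

End BoundedDerivatives.

(** * Layers and test functions *)

Section Layers.
Context {R : realType}.

Lemma linear_form_differentiable n (f : {linear 'cV[R]_n -> R}) x :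
  differentiable f x.
Proof.
have -> : (f : _ -> _) = \sum_(i < n) (fun y : 'cV[R]_n => y i 0 *: f (delta_mx i 0)).
  apply/funext => y; rewrite fct_sumE {1}(col_sum_delta y) linear_sum.
  by apply: eq_bigr => i _; rewrite linearZ.
apply: differentiable_sum => j; apply: differentiableZl.
exact: differentiable_coord.
Qed.

Lemma linear_form_diff n (f : {linear 'cV[R]_n -> R}) x : 'd f x = f :> (_ -> _).
Proof.
apply: diff_lin => y; apply: differentiable_continuous.
exact: linear_form_differentiable.
Qed.

Lemma affine_coord p q (A : 'M[R]_(q, p)) (b : 'cV[R]_q) i x :
  differentiable (fun y => (A *m y + b) i 0) x /\
  forall k, pd k (fun y => (A *m y + b) i 0) x = A i k.
Proof.
pose l (y : 'cV[R]_p) := (A *m y) i 0.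
have ll : linear l by move=> a y z; rewrite /l mulmxDr -scalemxAr !mxE.
pose L := GRing.isLinear.Build _ _ _ _ l ll.
pose f : {linear 'cV[R]_p -> R} := HB.pack l L.
have df := linear_form_differentiable f x.
have dc : differentiable (cst (b i 0) : 'cV[R]_p -> R) x.
  exact: differentiable_cst.
have -> : (fun y => (A *m y + b) i 0) = (f : _ -> _) + cst (b i 0).
  by apply/funext => y; rewrite mxE.
split; first exact: differentiableD.
move=> k; rewrite /pd.
have E : 'd ((f : _ -> _) + cst (b i 0)) x (delta_mx k 0) =
    'd f x (delta_mx k 0) + 'd (cst (b i 0)) x (delta_mx k 0).
  exact: (congr1 (@^~ (delta_mx k 0)) (diffD df dc)).
apply: (eq_trans E).
have -> : 'd (cst (b i 0)) x (delta_mx k 0) = 0.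
  exact: (congr1 (@^~ (delta_mx k 0)) (diff_cst (b i 0) x)).
rewrite addr0; apply: (eq_trans (congr1 (@^~ (delta_mx k 0)) (linear_form_diff f x))).
rewrite /= /l mxE (bigD1 k)//= mxE !eqxx mulr1 big1 ?addr0// => j jk.
by rewrite mxE (negPf jk) mulr0.
Qed.

Lemma activation_coord (sigma : R -> R) p q (A : 'M[R]_(q, p)) (b : 'cV[R]_q)
    i j x : activation_C4b sigma -> (j < 4)%N ->
  differentiable (fun y => sigma^`(j)%classic ((A *m y + b) i 0)) x /\
  forall k, pd k (fun y => sigma^`(j)%classic ((A *m y + b) i 0)) x =
    A i k * sigma^`(j.+1)%classic ((A *m x + b) i 0).
Proof.
move=> [ds _ _] j4.
have [da pa] := affine_coord A b i x.
set a := (fun y => (A *m y + b) i 0) in da pa *.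
have dsj : differentiable (sigma^`(j)%classic) (a x).
  by apply/derivable1_diffP; exact: ds.
rewrite (_ : (fun y => _) = sigma^`(j)%classic \o a)//.
split; first exact: differentiable_comp.
move=> k.
have E : pd k (sigma^`(j)%classic \o a) x = 'd (sigma^`(j)%classic) (a x) (pd k a x).
  exact: (congr1 (@^~ (delta_mx k 0)) (diff_comp da dsj)).
rewrite E pa.
have E2 := congr1 (@^~ (A i k)) (deriv1E (ds j (a x) j4)).
by apply: (eq_trans E2); rewrite derive1nS.
Qed.

(** [j] is positive because [sigma] itself may be unbounded. Each partial derivative trades one unit
    of [m] for one more derivative of [sigma], up to order 4. *)
Lemma activation_Cb (sigma : R -> R) (M : R) p q (A : 'M[R]_(q, p))
    (b : 'cV[R]_q) i : activation_C4b sigma ->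
  (forall j x, (1 <= j <= 4)%N -> `|sigma^`(j)%classic x| <= M) ->
  forall m, exists L, forall j, (0 < j)%N -> (j + m <= 4)%N ->
    Cb m L (fun y => sigma^`(j)%classic ((A *m y + b) i 0)).
Proof.
move=> hs HM; elim=> [|m [L IH]].
  by exists M => j j0; rewrite addn0 => j4; split=> // x; apply: HM; rewrite j0.
exists (Num.max M (2 ^+ m * ((\sum_k `|A i k|) * L))) => j j0 jm.
have j4 : (j < 4)%N by apply: leq_trans jm; rewrite -[ltnLHS]addn0 ltn_add2l.
split.
  by move=> x; rewrite le_max HM// j0/= ltnW.
split; first by move=> x; exact: (activation_coord _ _ _ _ hs j4).1.
move=> k; rewrite (_ : pd k _ = fun x => A i k * sigma^`(j.+1)%classic ((A *m x + b) i 0)).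
  apply: (@Cb_mono _ _ (2 ^+ m * ((\sum_k `|A i k|) * L))).
    by rewrite le_max lexx orbT.
  apply: CbM; last by apply: IH => //; rewrite addSnnS.
  apply: Cb_mono (Cb_cst _ _ _).
  by rewrite (bigD1 k)//= lerDl sumr_ge0.
by apply/funext => x; exact: (activation_coord _ _ _ _ hs j4).2.
Qed.

Lemma derivs_boundedD m M M' n (f g : 'cV[R]_n -> R) :
  derivs_bounded m M f -> derivs_bounded m M' g ->
  derivs_bounded m (M + M') (fun x => f x + g x).
Proof.
move=> [df Hf] [dg Hg]; split; first by move=> x; exact: differentiableD.
by move=> i; rewrite (pdD _ df dg); exact: CbD (Hf i) (Hg i).
Qed.

Lemma derivs_bounded_mono m M M' n (f : 'cV[R]_n -> R) : M <= M' ->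
  derivs_bounded m M f -> derivs_bounded m M' f.
Proof. by move=> MM' [df Hf]; split=> // i; exact: Cb_mono (Hf i). Qed.

Lemma layer_derivs_bounded (sigma : R -> R) p q (A C : 'M[R]_(q, p))
    (b c : 'cV[R]_q) : activation_C4b sigma ->
  exists L, forall i, derivs_bounded 3 L (fun x => layer sigma A b C c x i 0).
Proof.
move=> hs; have [ds _ [M HM]] := hs.
suff H i : exists L, derivs_bounded 3 L (fun x => layer sigma A b C c x i 0).
  have [L HL] := choice H.
  exists (\sum_i `|L i|) => i; apply: derivs_bounded_mono (HL i).
  by rewrite (bigD1 i)//= (le_trans (ler_norm _))// lerDl sumr_ge0.
have [L HL] := activation_Cb A b i hs HM 3.
exists ((2 ^+ 3 * ((\sum_k `|A i k|) * L)) + \sum_k `|C i k|).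
rewrite (_ : (fun x => _) =
  fun x => sigma^`(0)%classic ((A *m x + b) i 0) + (C *m x + c) i 0); last first.
  by apply/funext => x; rewrite /layer !mxE -addrA.
apply: derivs_boundedD.
  split; first by move=> x; exact: (activation_coord _ _ _ _ hs _).1.
  move=> k.
  rewrite (_ : pd k _ = fun x => A i k * sigma^`(1)%classic ((A *m x + b) i 0)).
    apply: CbM; last exact: HL.
    apply: Cb_mono (Cb_cst _ _ _).
    by rewrite (bigD1 k)//= lerDl sumr_ge0.
  by apply/funext => x; exact: (activation_coord _ _ _ _ hs _).2.
split; first by move=> x; exact: (affine_coord _ _ _ _).1.
move=> k; rewrite (_ : pd k _ = fun=> C i k).
  apply: Cb_mono (Cb_cst _ _ _).
  by rewrite (bigD1 k)//= lerDl sumr_ge0.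
by apply/funext => x; exact: (affine_coord _ _ _ _).2.
Qed.

Lemma iterdiff_le1 n (h : 'cV[R]_n -> R) vs x : (W4norm h <= 1)%E ->
  (1 <= size vs <= 4)%N -> (forall i, l2norm (nth 0 vs i) <= 1) ->
  `|iterdiff h vs x| <= 1.
Proof.
move=> h1 svs Hvs; rewrite -lee_fin; apply: le_trans h1.
suff H : (multilinear_opnorm (fun vs' : (size vs).-tuple 'cV[R]_n => iterdiff h vs' x)
    <= W4norm h)%E.
  apply: le_trans H; apply: ereal_sup_ubound; exists (in_tuple vs) => //= i.
  by rewrite (tnth_nth 0).
apply: (@le_trans _ _ (ereal_sup [set multilinear_opnorm
  (fun vs' : (size vs).-tuple 'cV[R]_n => iterdiff h vs' x)
              | x in [set: 'cV[R]_n]])).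
  by apply: ereal_sup_ubound; exists x.
rewrite /W4norm; apply: (le_bigmax_seq _ (size vs) _
  (fun j => ereal_sup [set multilinear_opnorm
    (fun vs' : j.-tuple 'cV[R]_n => iterdiff h vs' x) | x in [set: 'cV[R]_n]])) => //.
by rewrite mem_index_iota.
Qed.

(** Basis vectors have Euclidean norm 1, so the iterated partials of orders 1 to 4 are values of D^j
    h on unit vectors and inherit the bound from [W4norm]. *)
Lemma test_derivs_bounded n (h : 'cV[R]_n -> R) : classC 4 h ->
  (W4norm h <= 1)%E -> derivs_bounded 3 1 h.
Proof.
move=> [dh _] h1.
have l2e i : l2norm (delta_mx i 0 : 'cV[R]_n) <= 1.
  rewrite /l2norm (bigD1 i)//= mxE !eqxx expr1n big1 ?addr0 ?sqrtr1// => j ji.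
  by rewrite mxE (negPf ji) expr0n.
(* Beyond the end of the list [nth] returns its default 0, so the bound on directions must hold
   there too. *)
have l20 : l2norm (0 : 'cV[R]_n) <= 1.
  rewrite /l2norm big1 ?sqrtr0// => i _; by rewrite mxE expr0n.
suff H m vs : (0 < size vs)%N -> (size vs + m <= 4)%N ->
    (forall i, l2norm (nth 0 vs i) <= 1) -> Cb m 1 (iterdiff h vs).
  split; first by move=> x; exact: (dh [::]).
  move=> i; apply: (H 3%N [:: delta_mx i 0]) => //.
  by case=> [|k] /=; rewrite ?nth_nil; [exact: l2e|exact: l20].
elim: m vs => [|m IH] vs vs0 vsm Hvs.
  by split=> // x; apply: iterdiff_le1 => //; rewrite vs0 -(addn0 (size vs)).
have v4 : (size vs < 4)%N by apply: leq_trans vsm; rewrite -[ltnLHS]addn0 ltn_add2l.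
split; first by move=> x; apply: iterdiff_le1 => //; rewrite vs0 ltnW.
split; first by move=> x; exact: dh.
move=> i; apply: (IH (delta_mx i 0 :: vs)) => //=; first by rewrite addSnnS.
by case=> [|k] /=; [exact: l2e|exact: Hvs].
Qed.

End Layers.

(** * Moment generating function of the normal law *)

Section NormalMGF.
Context {R : realType}.
Local Notation mu := (@lebesgue_measure R).

(** The Radon-Nikodym derivative has the same integral as [normal_pdf] on every measurable set,
    hence equals it almost everywhere. *)
Lemma integral_normal_prob (m s : R) (f : R -> \bar R) :
  (forall x, (0 <= f x)%E) -> measurable_fun [set: R] f ->
  (\int[normal_prob m s]_x f x = \int[mu]_x (f x * (normal_pdf m s x)%:E))%E.
Proof.
move=> f0 mf.
have dom := normal_prob_dominates m s.
have mpdf : measurable_fun [set: R] (EFin \o normal_pdf m s).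
  by apply/measurable_EFinP; exact: measurable_normal_pdf.
have irn := Radon_Nikodym_SigmaFinite.f_integrable dom.
rewrite -(Radon_Nikodym_SigmaFinite.change_of_variables dom)//.
apply: ae_eq_integral => //.
- by apply: emeasurable_funM => //; exact: measurable_int irn.
- exact: emeasurable_funM.
- apply: ae_eqe_mul2l; apply: integral_ae_eq => // E _ mE.
  by rewrite -Radon_Nikodym_SigmaFinite.f_integral.
Qed.

Lemma normal_mgf (m s t : R) : s != 0 ->
  (\int[normal_prob m s]_x (expR (t * x))%:E =
   (expR (t * m + t ^+ 2 * s ^+ 2 / 2))%:E)%E.
Proof.
move=> s0; rewrite integral_normal_prob//; last first.
  apply/measurable_EFinP; apply: continuous_measurable_fun => x.
  apply: continuous_comp; [exact: mulrl_continuous|exact: continuous_expR].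
(* Completing the square: exp(t x) times the density of mean m is a constant times the density of
   mean m + t s^2. *)
transitivity (\int[mu]_x ((expR (t * m + t ^+ 2 * s ^+ 2 / 2))%:E *
    (normal_pdf (m + t * s ^+ 2) s x)%:E))%E.
  apply: eq_integral => x _; rewrite -!EFinM /normal_pdf (negPf s0) /normal_fun.
  rewrite !(mulrCA (expR _)) -!expRD.
  by congr (_ * expR _)%:E; field.
rewrite integralZl//; last exact: integrable_normal_pdf.
by rewrite integral_normal_pdf mule1.
Qed.

(** The same formula covers the Dirac mass at [v] = 0, so singular covariances need no separate
    treatment afterwards. *)
Lemma normal_law1_mgf d (T : measurableType d) (P : probability T R) (Y : T -> R)
    (m v t : R) :
  measurable_fun [set: T] Y -> 0 <= v ->
  (forall B, measurable B -> P [set w | B (Y w)] = normal_law1 m v B) ->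
  (\int[P]_w (expR (t * Y w))%:E = (expR (t * m + t ^+ 2 * v / 2))%:E)%E.
Proof.
move=> mY v0 PY.
pose f (x : R) := (expR (t * x))%:E.
have mf : measurable_fun [set: measurableTypeR R] f.
  apply/measurable_EFinP; apply: continuous_measurable_fun => x.
  apply: continuous_comp; [exact: mulrl_continuous|exact: continuous_expR].
have f0 (x : R) : (0 <= f x)%E by rewrite lee_fin expR_ge0.
have mY' : @measurable_fun _ _ T (measurableTypeR R) [set: T] Y by exact: mY.
have -> : (\int[P]_w (expR (t * Y w))%:E =
    \int[@pushforward _ _ T (measurableTypeR R) R P Y]_x f x)%E.
  by rewrite (ge0_integral_pushforward mY')// => x _; exact: f0.
move: PY; rewrite /normal_law1; have [->|vn0] := eqVneq v 0 => PY.
  transitivity (\int[@dirac _ (measurableTypeR R) m R]_x f x)%E.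
    by apply: eq_measure_integral => B mB _; exact: PY.
  by rewrite integral_dirac// diracT mul1e /f mulr0 mul0r addr0.
transitivity (\int[normal_prob m (Num.sqrt v)]_x f x)%E.
  by apply: eq_measure_integral => B mB _; exact: PY.
rewrite normal_mgf ?sqr_sqrtr// sqrtr_eq0 -ltNge lt_neqAle eq_sym vn0.
exact: v0.
Qed.

End NormalMGF.

(** * Moments from a moment generating function *)

Section ExponentialBounds.
Context {R : realType}.

(** |x|^k / k! is bounded by the exponential series at |x|. This makes every power integrable once
    the moment generating function is finite. *)
Lemma normX_le_expR k (x : R) :
  `|x| ^+ k <= k`!%:R * (expR x + expR (- x)).
Proof.
apply: (@le_trans _ _ (k`!%:R * expR `|x|)).
  have f0 : 0 < k`!%:R :> R by rewrite ltr0n fact_gt0.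
  rewrite mulrC -ler_pdivrMr//; case: k f0 => [|k] f0.
    by rewrite expr0 fact0 divr1 -(expR0 R) ler_expR.
  by apply: le_trans (expR_ge1Dxn k (normr_ge0 x)); rewrite lerDr.
rewrite ler_wpM2l//; case: (ger0P x) => _; first by rewrite lerDl expR_ge0.
by rewrite lerDr expR_ge0.
Qed.

(** Truncated exponential series differentiate into one another, so the mean value theorem lowers
    [k] by one. *)
Lemma expR_taylor k (x : R) :
  `|expR x - \sum_(j < k) x ^+ j / j`!%:R| <= `|x| ^+ k * expR `|x|.
Proof.
elim: k x => [|k IH] x.
  by rewrite big_ord0 subr0 expr0 mul1r ger0_norm ?expR_ge0// ler_expR ler_norm.
pose p m : {poly R} := \poly_(j < m) (j`!%:R)^-1.
have pE m t : \sum_(j < m) t ^+ j / j`!%:R = (p m).[t].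
  by rewrite horner_poly; apply: eq_bigr => j _; rewrite mulrC.
have dp : deriv (p k.+1) = p k.
  apply/polyP => j; rewrite coef_deriv !coef_poly ltnS.
  case: ltnP => // _; last by rewrite mul0rn.
  have j0 : j.+1%:R != 0 :> R by rewrite pnatr_eq0.
  by rewrite -[LHS]mulr_natl factS natrM invfM mulVKf.
have p0 : (p k.+1).[0] = 1.
  rewrite -pE big_ord_recl /= expr0 fact0 divr1 big1 ?addr0// => j _.
  by rewrite exprS mul0r mul0r.
have dpsi (t : R) : is_derive t 1 (fun t => expR t - (p k.+1).[t]) (expR t - (p k).[t]).
  by rewrite -dp; apply: is_deriveB.
have cpsi : continuous (fun t => expR t - (p k.+1).[t]).
  move=> t; apply: differentiable_continuous.
  by apply/derivable1_diffP; exact: (@ex_derive _ _ _ _ _ _ _ (dpsi t)).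
(* The intermediate point lies between 0 and [x] for either sign of [x]; only |c| <= |x| is kept. *)
rewrite pE; have [c [cx ->]] : exists c, `|c| <= `|x| /\
    expR x - (p k.+1).[x] = (expR c - (p k).[c]) * x.
  have [x0|x0] := leP 0 x.
    have [c + E] := @MVT_segment R _ _ 0 x x0 (fun t _ => dpsi t)
      (continuous_subspaceT cpsi).
    rewrite in_itv /= => /andP[c0 cx]; exists c; split.
      by rewrite !ger0_norm.
    by rewrite expR0 p0 subrr !subr0 in E.
  have [c + E] := @MVT_segment R _ _ x 0 (ltW x0) (fun t _ => dpsi t)
    (continuous_subspaceT cpsi).
  rewrite in_itv /= => /andP[xc c0]; exists c; split.
    by rewrite !ler0_norm ?(ltW x0)// lerN2.
  by move: E; rewrite expR0 p0 subrr !sub0r mulrN => /oppr_inj.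
rewrite normrM exprSr -mulrA [`|x| * _]mulrC mulrA ler_wpM2r//.
apply: (le_trans _ (le_trans (IH c) _)); first by rewrite pE.
rewrite ler_pM ?exprn_ge0 ?expR_ge0 ?ler_expR//.
by rewrite lerXn2r ?nnegrE.
Qed.

Lemma eq0_le_scale (x K : R) :
  (forall t, 0 < t <= 1 -> `|x| <= K * t) -> x = 0.
Proof.
move=> H; apply/eqP/negPn/negP => x0.
have nx : 0 < `|x| by rewrite normr_gt0.
have xK : `|x| <= K by have := H 1; rewrite mulr1; apply; rewrite ltr01 lexx.
have K0 : 0 < K by exact: lt_le_trans xK.
(* This value of t would give |x| <= |x| / 2; it is at most 1 because |x| <= K, the case t = 1. *)
have := H (`|x| / (2 * K)).
have -> : K * (`|x| / (2 * K)) = `|x| / 2 by field; rewrite gt_eqF.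
have t0 : 0 < `|x| / (2 * K) by rewrite divr_gt0// mulr_gt0.
have t1 : `|x| / (2 * K) <= 1.
  by rewrite ler_pdivrMr ?mulr_gt0// mul1r; lra.
rewrite t0 t1 => /(_ isT); lra.
Qed.

(** Combining the bounds at t and -t separates even and odd parts; dividing each by its lowest power
    of t and letting t shrink kills the coefficients one by one. *)
Lemma cubic_eq0 (a b c K : R) :
  (forall t, `|t| <= 1 -> `|a * t + b * t ^+ 2 + c * t ^+ 3| <= K * t ^+ 4) ->
  [/\ a = 0, b = 0 & c = 0].
Proof.
move=> H.
have K0 : 0 <= K.
  have := H 1; rewrite normr1 !expr1n !mulr1 => /(_ (lexx _)); exact: le_trans.
have even_odd t : 0 < t <= 1 ->
    `|b * t ^+ 2| <= K * t ^+ 4 /\ `|a * t + c * t ^+ 3| <= K * t ^+ 4.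
  move=> /andP[t0 t1]; have Hp := H t; have := H (- t).
  move: Hp; rewrite normrN (ger0_norm (ltW t0)) => /(_ t1) + /(_ t1).
  rewrite (_ : (- t) ^+ 4 = t ^+ 4); last by ring.
  rewrite (_ : a * - t + _ + _ = b * t ^+ 2 - (a * t + c * t ^+ 3)); last by ring.
  rewrite (_ : a * t + _ + _ = b * t ^+ 2 + (a * t + c * t ^+ 3)); last by ring.
  by rewrite !ler_norml => /andP[? ?] /andP[? ?]; split; apply/andP; split; lra.
have b0 : b = 0.
  apply: (@eq0_le_scale _ K) => t t01; have [+ _] := even_odd t t01.
  case/andP: t01 => t0 t1; rewrite normrM (ger0_norm (sqr_ge0 _)).
  rewrite -[4%N]/(2 + 2)%N exprD [K * _]mulrA ler_pM2r ?exprn_gt0// => /le_trans; apply.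
  by rewrite ler_wpM2l// expr2 ler_piMl// ltW.
have a0 : a = 0.
  apply: (@eq0_le_scale _ (K + `|c|)) => t t01; have [_ +] := even_odd t t01.
  case/andP: t01 => t0 t1.
  rewrite (_ : a * t + _ = t * (a + c * t ^+ 2)); last by ring.
  rewrite [t ^+ 4]exprS [K * _]mulrCA normrM (gtr0_norm t0) ler_pM2l// => h.
  have -> : a = (a + c * t ^+ 2) - c * t ^+ 2 by rewrite addrK.
  rewrite (le_trans (ler_normB _ _))// mulrDl lerD//.
    by rewrite (le_trans h)// ler_wpM2l// exprS ler_piMr ?exprn_ile1 ?(ltW t0).
  by rewrite normrM ler_wpM2l// ger0_norm ?sqr_ge0// expr2 ler_piMl ?(ltW t0).
split=> //; apply: (@eq0_le_scale _ K) => t t01; have [_ +] := even_odd t t01.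
case/andP: t01 => t0 t1; rewrite a0 mul0r add0r normrM.
rewrite (ger0_norm (exprn_ge0 _ (ltW t0))) [t ^+ 4]exprS [K * _]mulrA.
by rewrite ler_pM2r ?exprn_gt0.
Qed.

End ExponentialBounds.

(** * Integrability and real-valued expectations *)

Section Expectation.
Context {R : realType} d (T : measurableType d) (P : probability T R).
Implicit Types f g : T -> R.

Definition intg f := P.-integrable [set: T] (EFin \o f).
Definition Ex f : R := \int[P]_w f w.

Lemma intg_cst c : intg (fun=> c).
Proof. exact: finite_measure_integrable_cst. Qed.

Lemma Ex_cst c : Ex (fun=> c) = c.
Proof. by rewrite /Ex Rintegral_cst// (congr1 fine (probability_setT P)) mulr1. Qed.

Lemma intg_measurable f : intg f -> measurable_fun [set: T] f.
Proof. by move=> /measurable_int/measurable_EFinP. Qed.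

Lemma intgD f g : intg f -> intg g -> intg (fun w => f w + g w).
Proof. by move=> hf hg; exact: (integrableD measurableT hf hg). Qed.

Lemma intgB f g : intg f -> intg g -> intg (fun w => f w - g w).
Proof. by move=> hf hg; exact: (integrableB measurableT hf hg). Qed.

Lemma intgZ c f : intg f -> intg (fun w => c * f w).
Proof. by move=> hf; exact: (integrableZl measurableT c hf). Qed.

Lemma intg_le f g : measurable_fun [set: T] f -> (forall w, `|f w| <= g w) ->
  intg g -> intg f.
Proof.
move=> mf fg hg; apply: (le_integrable measurableT _ _ hg).
  exact/measurable_EFinP.
by move=> w _ /=; rewrite lee_fin (le_trans (fg w))// ler_norm.
Qed.

Lemma intg_sum (I : Type) (r : seq I) (f : I -> T -> R) :
  (forall i, intg (f i)) -> intg (fun w => \sum_(i <- r) f i w).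
Proof.
move=> hf; elim: r => [|i r IH].
  by under eq_fun do rewrite big_nil; exact: intg_cst.
by under eq_fun do rewrite big_cons; exact: intgD.
Qed.

Lemma ExD f g : intg f -> intg g -> Ex (fun w => f w + g w) = Ex f + Ex g.
Proof. by move=> hf hg; rewrite /Ex RintegralD. Qed.

Lemma ExB f g : intg f -> intg g -> Ex (fun w => f w - g w) = Ex f - Ex g.
Proof. by move=> hf hg; rewrite /Ex RintegralB. Qed.

Lemma ExZ c f : intg f -> Ex (fun w => c * f w) = c * Ex f.
Proof. by move=> hf; rewrite /Ex RintegralZl. Qed.

Lemma Ex_sum (I : Type) (r : seq I) (f : I -> T -> R) :
  (forall i, intg (f i)) ->
  Ex (fun w => \sum_(i <- r) f i w) = \sum_(i <- r) Ex (f i).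
Proof.
move=> hf; elim: r => [|i r IH].
  by under eq_fun do rewrite big_nil; rewrite big_nil Ex_cst.
under eq_fun do rewrite big_cons; rewrite big_cons ExD ?IH//.
exact: intg_sum.
Qed.

Lemma Ex_le f g : intg f -> intg g -> (forall w, f w <= g w) -> Ex f <= Ex g.
Proof. by move=> hf hg fg; apply: le_Rintegral => // w _; exact: fg. Qed.

Lemma Ex_norm_le f g : measurable_fun [set: T] f -> intg g ->
  (forall w, `|f w| <= g w) -> `|Ex f| <= Ex g.
Proof.
move=> mf hg fg; have hf := intg_le mf fg hg.
rewrite ler_norml -[- Ex g]mulN1r -ExZ//; apply/andP; split.
  apply: Ex_le => //; first exact: intgZ.
  by move=> w; rewrite mulN1r; have := fg w; rewrite ler_norml => /andP[].
by apply: Ex_le => // w; rewrite (le_trans (ler_norm _)).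
Qed.

Lemma expectation_Ex f : intg f -> expectation P f = (Ex f)%:E.
Proof.
by move=> hf; rewrite unlock /Ex /Rintegral fineK//; exact: integrable_fin_num.
Qed.

End Expectation.

(** * Moments of a centred normal variable, up to order four *)

Section MomentsFromMGF.
Context {R : realType} d (T : measurableType d) (P : probability T R).
Variables (Y : T -> R) (v : R).
Hypotheses (mY : measurable_fun [set: T] Y) (v0 : 0 <= v).
Hypothesis mgfY : forall t,
  (\int[P]_w (expR (t * Y w))%:E = (expR (t ^+ 2 * v / 2))%:E)%E.

Lemma mgf_measurable t : measurable_fun [set: T] (fun w => expR (t * Y w)).
Proof.
apply: measurableT_comp; first exact: measurable_expR.
exact: measurable_funM.
Qed.

Lemma mgf_intg t : intg P (fun w => expR (t * Y w)).
Proof.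
apply/integrableP; split; first by apply/measurable_EFinP; exact: mgf_measurable.
under eq_integral do rewrite /= ger0_norm ?expR_ge0//.
by rewrite mgfY ltry.
Qed.

Lemma mgf_Ex t : Ex P (fun w => expR (t * Y w)) = expR (t ^+ 2 * v / 2).
Proof. by rewrite /Ex /Rintegral mgfY. Qed.

Lemma mgf_intgX k : intg P (fun w => Y w ^+ k).
Proof.
apply: (@intg_le _ _ _ _ _ (fun w => k`!%:R * (expR (1 * Y w) + expR (-1 * Y w)))).
- exact: measurable_funX.
- by move=> w; rewrite normrX mulN1r mul1r normX_le_expR.
- by apply: intgZ; apply: intgD; exact: mgf_intg.
Qed.

(** At [t] = 1 / sqrt(u), (t Y)^4 <= 24 (exp(t Y) + exp(-t Y)), and the right side has mean 48
    exp(t^2 v / 2) <= 48 e. The scale is [u] rather than [v] because [v] may be 0. *)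
Lemma mgf_Ex4 u : 0 < u -> v <= u -> Ex P (fun w => Y w ^+ 4) <= 48 * expR 1 * u ^+ 2.
Proof.
move=> u0 vu; pose t := (Num.sqrt u)^-1.
have t2 : t ^+ 2 = u^-1 by rewrite exprVn sqr_sqrtr ?ltW.
have h : t ^+ 4 * Ex P (fun w => Y w ^+ 4) <= 48 * expR (t ^+ 2 * v / 2).
  rewrite -ExZ; last exact: mgf_intgX.
  have -> : 48 * expR (t ^+ 2 * v / 2) =
      Ex P (fun w => 24 * (expR (t * Y w) + expR (- t * Y w))).
    rewrite ExZ; last by apply: intgD; exact: mgf_intg.
    rewrite ExD; try exact: mgf_intg.
    by rewrite !mgf_Ex sqrrN; lra.
  apply: Ex_le.
  - by apply: intgZ; exact: mgf_intgX.
  - by apply: intgZ; apply: intgD; exact: mgf_intg.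
  move=> w; have := normX_le_expR 4 (t * Y w).
  by rewrite -mulNr -normrX ger0_norm ?exprn_even_ge0// exprMn.
have t4 : t ^+ 4 = (u ^+ 2)^-1 by rewrite -[4%N]/(2 * 2)%N exprM t2 exprVn.
have h2 : expR (t ^+ 2 * v / 2) <= expR 1.
  rewrite ler_expR t2 ler_pdivrMr// mul1r mulrC ler_pdivrMr//; lra.
rewrite t4 mulrC ler_pdivrMr ?exprn_gt0// in h.
apply: (le_trans h); rewrite ler_wpM2r ?sqr_ge0//.
by rewrite ler_wpM2l.
Qed.

(** Both sides of E exp(t Y) = exp(t^2 v / 2) are expanded with error O(t^4) for |t| <= 1, and
    [cubic_eq0] identifies the coefficients of t, t^2 and t^3. *)
Lemma mgf_moments : [/\ Ex P Y = 0, Ex P (fun w => Y w ^+ 2) = v &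
  Ex P (fun w => Y w ^+ 3) = 0].
Proof.
(* This is 24 (exp(Y) + exp(-Y))^2: one factor, with the 24, bounds Y^4 and the other bounds exp(|t
   Y|) for |t| <= 1. Expanded, it is integrable by the moment generating function at 2 and -2. *)
pose D w := 24 * (expR (2 * Y w) + 2 + expR (- 2 * Y w)).
have iD : intg P D.
  apply: intgZ; apply: intgD; last exact: mgf_intg.
  by apply: intgD; [exact: mgf_intg|exact: intg_cst].
have iX := mgf_intgX.
have i1 : intg P Y := iX 1%N.
pose a := Ex P Y; pose b := Ex P (fun w => Y w ^+ 2).
pose c := Ex P (fun w => Y w ^+ 3).
pose p t w := 1 + t * Y w + (t ^+ 2 / 2) * Y w ^+ 2 + (t ^+ 3 / 6) * Y w ^+ 3.
have j1 t := intgD (intg_cst P 1) (intgZ t i1).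
have j2 t := intgZ (t ^+ 2 / 2) (iX 2%N).
have j3 t := intgZ (t ^+ 3 / 6) (iX 3%N).
have ip t : intg P (p t) := intgD (intgD (j1 t) (j2 t)) (j3 t).
have Ep t : Ex P (p t) = 1 + t * a + (t ^+ 2 / 2) * b + (t ^+ 3 / 6) * c.
  rewrite (ExD (intgD (j1 t) (j2 t)) (j3 t)) (ExD (j1 t) (j2 t)).
  rewrite (ExD (intg_cst P 1) (intgZ t i1)) Ex_cst (ExZ t i1).
  by rewrite (ExZ _ (iX 2%N)) (ExZ _ (iX 3%N)).
have pt t w : `|t| <= 1 -> `|expR (t * Y w) - p t w| <= t ^+ 4 * D w.
  move=> t1; have := expR_taylor 4 (t * Y w).
  rewrite !big_ord_recl big_ord0 /= /bump /= !add1n addr0.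
  rewrite (_ : _ + _ = p t w); last first.
    by rewrite /p -[0`!]/1%N -[1`!]/1%N -[2`!]/2%N -[3`!]/6%N; field.
  move=> /le_trans; apply; rewrite -normrX ger0_norm ?exprn_even_ge0//.
  rewrite exprMn -mulrA ler_wpM2l ?exprn_even_ge0//.
  have hY := normX_le_expR 4 (Y w).
  rewrite -normrX ger0_norm ?exprn_even_ge0// in hY.
  have htY : expR `|t * Y w| <= expR (Y w) + expR (- Y w).
    apply: (@le_trans _ _ (expR `|Y w|)).
      by rewrite ler_expR normrM ler_piMl.
    by case: (ger0P (Y w)) => _; rewrite ?lerDl ?lerDr expR_ge0.
  apply: (@le_trans _ _ (24 * (expR (Y w) + expR (- Y w)) * (expR (Y w) + expR (- Y w)))).
    by rewrite ler_pM ?exprn_even_ge0 ?expR_ge0.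
  rewrite /D (_ : 2 * Y w = Y w + Y w); last by ring.
  rewrite (_ : -2 * Y w = - Y w - Y w); last by ring.
  rewrite !expRD -mulrA ler_wpM2l//.
  rewrite (_ : _ * _ = expR (Y w) * expR (Y w) + 2 * (expR (Y w) * expR (- Y w))
    + expR (- Y w) * expR (- Y w)); last by ring.
  by rewrite expRxMexpNx_1 mulr1.
have D0 : 0 <= Ex P D.
  rewrite -[leLHS](Ex_cst P 0); apply: Ex_le => //; first exact: intg_cst.
  by move=> w; rewrite mulr_ge0// !addr_ge0 ?expR_ge0.
have [a0 b0 c0] : [/\ a = 0, (b - v) / 2 = 0 & c / 6 = 0].
  apply: (@cubic_eq0 _ _ _ _ (Ex P D + v ^+ 2 * expR v)) => t t1.
  have t21 : t ^+ 2 <= 1 by rewrite -real_normK ?num_real// exprn_ile1.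
  have h1 : `|expR (t ^+ 2 * v / 2) - Ex P (p t)| <= t ^+ 4 * Ex P D.
    rewrite -mgf_Ex -ExB//; last exact: mgf_intg.
    rewrite -ExZ//; apply: Ex_norm_le.
    - by apply: intg_measurable (intgB (mgf_intg t) (ip t)).
    - exact: intgZ.
    - by move=> w; exact: pt.
  have h2 : `|expR (t ^+ 2 * v / 2) - (1 + t ^+ 2 * v / 2)| <= t ^+ 4 * (v ^+ 2 * expR v).
    have := expR_taylor 2 (t ^+ 2 * v / 2).
    rewrite !big_ord_recl big_ord0 /= /bump /= !add1n addr0.
    rewrite -[0`!]/1%N -[1`!]/1%N !divr1 expr0 expr1 => /le_trans; apply.
    have u0 : 0 <= t ^+ 2 * v / 2 by rewrite divr_ge0// mulr_ge0// sqr_ge0.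
    rewrite ger0_norm// mulrA ler_pM ?exprn_ge0 ?expR_ge0//; last first.
      rewrite ler_expR ler_pdivrMr// mulrC.
      by apply: ler_pM => //; [exact: sqr_ge0|lra].
    rewrite -mulrA exprMn -exprM ler_wpM2l ?exprn_even_ge0//.
    rewrite lerXn2r ?nnegrE ?divr_ge0//.
    by rewrite ler_pdivrMr// ler_peMr// ler1n.
  rewrite Ep in h1.
  rewrite (_ : a * t + _ + _ = (expR (t ^+ 2 * v / 2) - (1 + t ^+ 2 * v / 2)) -
    (expR (t ^+ 2 * v / 2) - (1 + t * a + (t ^+ 2 / 2) * b + (t ^+ 3 / 6) * c))); last by field.
  apply: (le_trans (ler_normB _ _)); rewrite mulrDl [leRHS]addrC.
  by apply: lerD; rewrite [leRHS]mulrC; [exact: h2|exact: h1].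
split; [exact: a0|rewrite -/b; lra|rewrite -/c; lra].
Qed.

End MomentsFromMGF.

(** * Normal vectors *)

Section MeasurableVectors.
Context {R : realType} d (T : measurableType d).

(** An open set is a countable union of cubes with rational centres and radii 1/(k+1); the preimage
    of a cube is a finite intersection of coordinate conditions. *)
Lemma measurable_vec_preimage_open n (U : T -> 'cV[R]_n) (O : set 'cV[R]_n) :
  measurable_vec U -> open O -> measurable (U @^-1` O).
Proof.
move=> mU oO.
pose B (p : 'cV[rat]_n * nat) : set 'cV[R]_n :=
  [set y | forall i, `|ratr (p.1 i 0) - y i 0| < p.2.+1%:R^-1].
(* Codes of no cube, or of a cube not contained in [O], contribute the empty set. *)
pose F k := if (unpickle k : option ('cV[rat]_n * nat)) is Some p then
  if `[< B p `<=` O >] then U @^-1` B p else set0 else set0.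
have -> : U @^-1` O = \bigcup_k F k.
  apply/seteqP; split => [w /= Ow|w [k _]]; last first.
    rewrite /F; case: (unpickle k) => // p; case: asboolP => // BO.
    exact: BO.
  have /nbhs_ballP[e /= e0 eO] : nbhs (U w) O by exact: open_nbhs_nbhs.
  have e20 : 0 < e / 2 by rewrite divr_gt0.
  have [k ke] : exists k, k.+1%:R^-1 < e / 2.
    exists (Num.truncn (e / 2)^-1); rewrite invf_plt ?posrE//.
    exact: Num.Theory.truncnS_gt.
  (* With radius r < e/2 and a centre within r of [U w], the cube contains [U w] and lies in the
     ball of radius e around it. *)
  have /choice[q Hq] : forall i, exists r : rat, `|ratr r - U w i 0| < k.+1%:R^-1.
    move=> i; have [|r] := @rat_in_itvoo R (U w i 0) (U w i 0 + k.+1%:R^-1).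
      by rewrite ltrDl invr_gt0.
    rewrite in_itv /= => /andP[r1 r2]; exists r.
    by rewrite ger0_norm ?subr_ge0 ?ltW// ltrBlDl.
  pose p : 'cV[rat]_n * nat := (\col_i q i, k).
  exists (pickle p) => //; rewrite /F pickleK; case: asboolP => [_|[]].
    by move=> i /=; rewrite mxE.
  move=> y By; apply: eO; split => // i j; rewrite ord1.
  have := By i; rewrite /= mxE => Byi.
  rewrite (splitr e); apply: (@le_lt_trans _ _ (`|ratr (q i) - U w i 0| + `|ratr (q i) - y i 0|)).
    rewrite [`|ratr (q i) - U w i 0|]distrC.
    by apply: le_trans (ler_normD _ _); rewrite addrA subrK.
  by rewrite ltrD// (lt_trans _ ke).
apply: bigcup_measurable => k _; rewrite /F; case: (unpickle k) => // p.
case: asboolP => // _.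
rewrite (_ : U @^-1` B p =
  \bigcap_(i in [set: 'I_n]) [set w | `|ratr (p.1 i 0) - U w i 0| < p.2.+1%:R^-1]).
  apply: fin_bigcap_measurable => //= i _.
  have mf : measurable_fun [set: T] (fun w => `|ratr (p.1 i 0) - U w i 0|).
    apply: measurableT_comp => //; apply: measurable_funB => //; exact: mU.
  rewrite -[X in measurable X]setTI.
  have mI : measurable `]-oo, (p.2.+1%:R^-1 : R)[ by exact: measurable_itv.
  by have := mf measurableT _ mI; rewrite set_itvNyo.
by apply/seteqP; split => w /= H => [i _|i]; [exact: H|exact: (H i I)].
Qed.

Lemma measurable_vec_comp n (U : T -> 'cV[R]_n) (h : 'cV[R]_n -> R) :
  measurable_vec U -> continuous h -> measurable_fun [set: T] (fun w => h (U w)).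
Proof.
move=> mU ch; apply: (measurability _ (RGenOpens.measurableE R)).
move=> _ [_ [a [b ->] <-]]; rewrite setTI.
apply: (@measurable_vec_preimage_open _ U (h @^-1` `]a, b[)) => //.
by apply: open_comp; [move=> x _; exact: ch|exact: interval_open].
Qed.

End MeasurableVectors.

Section NormalVectors.
Context {R : realType} d (T : measurableType d) (P : probability T R).

Definition dot n (t x : 'cV[R]_n) : R := (t^T *m x) 0 0.

Lemma dotDl n (s t x : 'cV[R]_n) : dot (s + t) x = dot s x + dot t x.
Proof. by rewrite /dot linearD mulmxDl mxE. Qed.

Lemma dotBl n (s t x : 'cV[R]_n) : dot (s - t) x = dot s x - dot t x.
Proof. by rewrite /dot linearB mulmxBl !mxE. Qed.

Lemma dotBr n (s x y : 'cV[R]_n) : dot s (x - y) = dot s x - dot s y.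
Proof. by rewrite /dot mulmxBr !mxE. Qed.

Lemma dotE n (t x : 'cV[R]_n) : dot t x = \sum_i t i 0 * x i 0.
Proof. by rewrite /dot mxE; apply: eq_bigr => i _; rewrite mxE. Qed.

Lemma dot_delta n i (x : 'cV[R]_n) : dot (delta_mx i 0) x = x i 0.
Proof.
rewrite dotE (bigD1 i)//= mxE !eqxx mul1r big1 ?addr0// => j ji.
by rewrite mxE (negPf ji) mul0r.
Qed.

Lemma measurable_dot n (U : T -> 'cV[R]_n) t : measurable_vec U ->
  measurable_fun [set: T] (fun w => dot t (U w)).
Proof.
move=> mU; under eq_fun do rewrite dotE.
by apply: measurable_sum => i; apply: measurable_funM => //; exact: mU.
Qed.

Variables (n : nat) (U : T -> 'cV[R]_n) (m : 'cV[R]_n) (S : 'M[R]_n).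
Hypothesis normU : has_normal_law P U m S.

Let mU : measurable_vec U. Proof. by case: normU. Qed.

Let y t w := dot t (U w - m).

Let yD s t w : y (s + t) w = y s w + y t w. Proof. exact: dotDl. Qed.

Let yB s t w : y (s - t) w = y s w - y t w. Proof. exact: dotBl. Qed.

Let form (s t : 'cV[R]_n) := (s^T *m S *m t) 0 0.

Lemma normal_linear_measurable t : measurable_fun [set: T] (fun w => dot t (U w - m)).
Proof.
under eq_fun do rewrite dotBr.
by apply: measurable_funB => //; exact: measurable_dot.
Qed.

Lemma normal_linear_mgf t r :
  (\int[P]_w (expR (r * dot t (U w - m)))%:E = (expR (r ^+ 2 * form t t / 2))%:E)%E.
Proof.
have [_ _ /(_ t)[v0 PU]] := normU.
have E := normal_law1_mgf r (measurable_dot t mU) v0 PU.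
transitivity (\int[P]_w ((expR (- r * dot t m))%:E * (expR (r * dot t (U w)))%:E))%E.
  apply: eq_integral => w _; rewrite -EFinM -expRD dotBr; congr (expR _)%:E; ring.
have me : measurable_fun [set: T] (fun w => (expR (r * dot t (U w)))%:E).
  apply/measurable_EFinP; apply: measurableT_comp; first exact: measurable_expR.
  by apply: measurable_funM => //; exact: measurable_dot.
rewrite ge0_integralZl//; try by move=> *; rewrite lee_fin expR_ge0.
rewrite E -EFinM -expRD -/(form t t) -/(dot t m); congr (expR _)%:E; ring.
Qed.

Let form_ge0 t : 0 <= form t t.
Proof. by have [_ _ /(_ t)[]] := normU. Qed.

Let y_intgX k t : intg P (fun w => y t w ^+ k) :=
  mgf_intgX (normal_linear_measurable t) (normal_linear_mgf t) k.

Lemma normal_linear_intg t : intg P (fun w => dot t (U w - m)).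
Proof. exact: (y_intgX 1 t). Qed.

Lemma normal_linear_Ex t : Ex P (fun w => dot t (U w - m)) = 0.
Proof.
by have [] := mgf_moments (normal_linear_measurable t) (form_ge0 t) (normal_linear_mgf t).
Qed.

Let y_Ex2 t : Ex P (fun w => y t w ^+ 2) = form t t.
Proof.
by have [] := mgf_moments (normal_linear_measurable t) (form_ge0 t) (normal_linear_mgf t).
Qed.

Let y_Ex3 t : Ex P (fun w => y t w ^+ 3) = 0.
Proof.
by have [] := mgf_moments (normal_linear_measurable t) (form_ge0 t) (normal_linear_mgf t).
Qed.

(* Only linear functionals of [U] have a known law; mixed moments are recovered
   by polarization. *)
Lemma normal_quadratic s t :
  intg P (fun w => dot s (U w - m) * dot t (U w - m)) /\
  Ex P (fun w => dot s (U w - m) * dot t (U w - m)) = (s^T *m S *m t) 0 0.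
Proof.
have E : (fun w => dot s (U w - m) * dot t (U w - m)) =
    (fun w => 4^-1 * (y (s + t) w ^+ 2 - y (s - t) w ^+ 2)).
  by apply/funext => w; rewrite yD yB /y; field.
rewrite E; split; first by apply: intgZ; apply: intgB; exact: y_intgX.
rewrite ExZ; last by apply: intgB; exact: y_intgX.
rewrite ExB; [|exact: y_intgX|exact: y_intgX]; rewrite !y_Ex2.
have [_ symS _] := normU.
have sym : form t s = form s t.
  rewrite /form (_ : t^T *m S *m s = (s^T *m S *m t)^T) ?[_^T _ _]mxE//.
  by rewrite !trmx_mul trmxK symS mulmxA.
have addE (A B : 'M[R]_1) : (A + B) 0 0 = A 0 0 + B 0 0 by rewrite mxE.
have oppE (A : 'M[R]_1) : (- A) 0 0 = - A 0 0 by rewrite mxE.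
have -> : form (s + t) (s + t) = form s s + form t t + form s t + form t s.
  by rewrite /form [(s + t)^T]linearD /= !mulmxDl !mulmxDr !addE; ring.
have -> : form (s - t) (s - t) = form s s + form t t - form s t - form t s.
  by rewrite /form [(s - t)^T]linearB /= !mulmxBl !mulmxBr !(addE, oppE); ring.
by rewrite sym -/(form s t); field.
Qed.

(** Polarization: 24 r s t = (r+s+t)^3 - (r+s-t)^3 - (r-s+t)^3 + (r-s-t)^3, and each cube of a
    centred linear functional has mean 0. *)
Lemma normal_cubic r s t :
  intg P (fun w => dot r (U w - m) * dot s (U w - m) * dot t (U w - m)) /\
  Ex P (fun w => dot r (U w - m) * dot s (U w - m) * dot t (U w - m)) = 0.
Proof.
have E : (fun w => dot r (U w - m) * dot s (U w - m) * dot t (U w - m)) =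
    (fun w => 24^-1 * ((y (r + s + t) w ^+ 3 - y (r + s - t) w ^+ 3) -
      (y (r - s + t) w ^+ 3 - y (r - s - t) w ^+ 3))).
  by apply/funext => w; rewrite (yD (r - s) t) !yB (yD (r + s) t) (yD r s) /y; field.
have i3 a b : intg P (fun w => y a w ^+ 3 - y b w ^+ 3).
  by apply: intgB; exact: y_intgX.
rewrite E; split; first by apply: intgZ; exact: intgB.
rewrite ExZ; last exact: intgB.
rewrite ExB// !ExB; try exact: y_intgX.
by rewrite !y_Ex3; ring.
Qed.

Lemma normal_quartic i u : 0 < u -> S i i <= u ->
  intg P (fun w => (U w - m) i 0 ^+ 4) /\
  Ex P (fun w => (U w - m) i 0 ^+ 4) <= 48 * expR 1 * u ^+ 2.
Proof.
move=> u0 Su.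
have E : (fun w => (U w - m) i 0 ^+ 4) = (fun w => y (delta_mx i 0) w ^+ 4).
  by apply/funext => w; rewrite /y dot_delta.
rewrite E; split; first exact: y_intgX.
apply: (mgf_Ex4 (normal_linear_measurable _) (normal_linear_mgf _)) => //.
rewrite (_ : form _ _ = S i i)//.
by rewrite /form trmx_delta -rowE -colE !mxE.
Qed.

End NormalVectors.

(** * Comparison of expectations by Taylor expansion *)

Section MeanCovariance.
Context {R : realType} d (T : measurableType d) (P : probability T R).

Lemma mean_vecE n (U : T -> 'cV[R]_n) i :
  mean_vec P U i 0 = Ex P (fun w => U w i 0).
Proof. by rewrite mxE unlock. Qed.

Lemma cov_mxE n (U : T -> 'cV[R]_n) i j : cov_mx P U i j =
  Ex P (fun w => (U w - mean_vec P U) i 0 * (U w - mean_vec P U) j 0).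
Proof.
rewrite mxE covariance.unlock expectation.unlock /Ex /Rintegral.
by congr fine; apply: eq_integral => w _; rewrite !mxE expectation.unlock.
Qed.

Lemma normal_mean n (U : T -> 'cV[R]_n) m S :
  has_normal_law P U m S -> mean_vec P U = m.
Proof.
move=> hU; apply/matrixP => i k; rewrite ord1 mean_vecE.
have -> : (fun w => U w i 0) = (fun w => dot (delta_mx i 0) (U w - m) + m i 0).
  by apply/funext => w; rewrite dot_delta !mxE subrK.
rewrite ExD; [|exact: normal_linear_intg hU _|exact: intg_cst].
by rewrite (normal_linear_Ex hU) Ex_cst add0r.
Qed.

Lemma normal_cov_Ex n (U : T -> 'cV[R]_n) m S i j : has_normal_law P U m S ->
  intg P (fun w => (U w - m) i 0 * (U w - m) j 0) /\
  Ex P (fun w => (U w - m) i 0 * (U w - m) j 0) = S i j.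
Proof.
move=> hU; have := normal_quadratic hU (delta_mx i 0) (delta_mx j 0).
rewrite (_ : (fun w => _) = (fun w => (U w - m) i 0 * (U w - m) j 0)).
  by rewrite (_ : _ 0 0 = S i j)// trmx_delta -rowE -colE !mxE.
by apply/funext => w; rewrite !dot_delta.
Qed.

(** This carries the hypothesis on the covariance of the input over to the parameter [S] of its
    law. *)
Lemma normal_cov n (U : T -> 'cV[R]_n) m S :
  has_normal_law P U m S -> cov_mx P U = S.
Proof.
move=> hU; apply/matrixP => i j.
by rewrite cov_mxE (normal_mean hU) (normal_cov_Ex i j hU).2.
Qed.

End MeanCovariance.

Section Norms.
Context {R : realType}.

Lemma norm_coords_le n (y : 'cV[R]_n) (c : R) : 0 <= c ->
  (forall i, `|y i 0| <= c) -> `|y| <= c.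
Proof.
move=> c0 H; rewrite [leLHS]/Num.Def.normr /= mx_normrE.
by apply: bigmax_le => // -[i j] _; rewrite ord1.
Qed.

Lemma norm_pow4_le n (y : 'cV[R]_n) : `|y| ^+ 4 <= \sum_i y i 0 ^+ 4.
Proof.
have s0 : 0 <= \sum_i y i 0 ^+ 4 by apply: sumr_ge0 => i _; rewrite exprn_even_ge0.
have [y0|y0] := eqVneq `|y| 0; first by rewrite y0 expr0n.
have [[i j] /= yi] := mx_norm_neq0 y0; rewrite ord1 in yi.
rewrite [X in X ^+ _]yi -normrX ger0_norm ?exprn_even_ge0//.
by rewrite (bigD1 i)//= lerDl sumr_ge0// => k _; rewrite exprn_even_ge0.
Qed.

(** (x + y)^2 <= 2 (x^2 + y^2), used twice. *)
Lemma exprD4_le (a b : R) : (a + b) ^+ 4 <= 8 * (a ^+ 4 + b ^+ 4).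
Proof.
have sq (x y : R) : (x + y) ^+ 2 <= 2 * (x ^+ 2 + y ^+ 2).
  by have := sqr_ge0 (x - y); rewrite sqrrB sqrrD; lra.
have -> : (a + b) ^+ 4 = ((a + b) ^+ 2) ^+ 2 by rewrite -exprM.
apply: (@le_trans _ _ ((2 * (a ^+ 2 + b ^+ 2)) ^+ 2)).
  by rewrite lerXn2r ?nnegrE ?sqr_ge0// mulr_ge0// addr_ge0 ?sqr_ge0.
rewrite exprMn; have := sq (a ^+ 2) (b ^+ 2).
by rewrite -!exprM -[(2 * 2)%N]/4%N; lra.
Qed.

End Norms.

(** * Random variables of size [delta] *)

Section Scale.
Context {R : realType}.

(** The lower bound on [Z] lets its powers absorb deterministic quantities of order [delta]^k, so
    that later estimates are all pointwise bounds by powers of [Z]. *)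
Definition small_moments d (T : measurableType d) (P : probability T R)
    (Z : T -> R) (C delta : R) : Prop :=
  (forall w, delta <= Z w) /\
  forall k, (k <= 4)%N -> intg P (fun w => Z w ^+ k) /\
    Ex P (fun w => Z w ^+ k) <= C * delta ^+ k.

(** Only the fourth moment is estimated, coordinate by coordinate; the lower ones follow from Z^k
    delta^(4-k) <= Z^4. *)
Lemma normal_small_moments n (K : R) : exists2 C : R, 0 <= C &
  forall d (T : measurableType d) (P : probability T R) (U : T -> 'cV[R]_n)
    m S (delta : R), has_normal_law P U m S -> 0 < delta ->
    (forall i, S i i <= K * delta ^+ 2) ->
    small_moments P (fun w => `|U w - m| + delta) C delta.
Proof.
(* [|K| + 1] keeps the variance bound positive, as [normal_quartic] requires. *)
pose B : R := 48 * expR 1 * (`|K| + 1) ^+ 2.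
have B0 : 0 <= B by rewrite !mulr_ge0 ?expR_ge0 ?sqr_ge0.
exists (8 * (n%:R * B + 1)); first by rewrite mulr_ge0// addr_ge0// mulr_ge0.
move=> d T P U m S delta hU d0 HS.
set Z := fun w => _.
have Zd w : delta <= Z w by rewrite lerDr.
have Z0 w : 0 < Z w by exact: lt_le_trans (Zd w).
have u0 : 0 < (`|K| + 1) * delta ^+ 2 by rewrite mulr_gt0 ?exprn_gt0// ltr_wpDl.
have Su i : S i i <= (`|K| + 1) * delta ^+ 2.
  apply: (le_trans (HS i)); rewrite ler_wpM2r ?sqr_ge0//.
  by rewrite (le_trans (ler_norm _))// lerDl.
have H4 i := normal_quartic hU (i := i) u0 (Su i).
have mU : measurable_vec U by case: hU.
have mZ : measurable_fun [set: T] Z.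
  apply: measurable_funD => //.
  apply: (measurable_vec_comp (h := fun x => `|x - m|)) => // x.
  apply: (@continuous_comp _ _ _ (fun z : 'cV[R]_n => z - m) (fun z => `|z|)).
    apply: (@continuousB _ _ _ (fun z => z) (cst m)); last exact: cst_continuous.
    by move=> ?; exact.
  exact: norm_continuous.
pose D w := 8 * ((\sum_i (U w - m) i 0 ^+ 4) + delta ^+ 4).
have iS : intg P (fun w => \sum_i (U w - m) i 0 ^+ 4).
  by apply: intg_sum => i; exact: (H4 i).1.
have iD : intg P D by apply: intgZ; apply: intgD => //; exact: intg_cst.
have ED : Ex P D <= 8 * (n%:R * B + 1) * delta ^+ 4.
  rewrite ExZ; last by apply: intgD => //; exact: intg_cst.
  rewrite ExD ?Ex_cst//; last exact: intg_cst.
  rewrite -mulrA ler_wpM2l// mulrDl mul1r lerD2r Ex_sum; last by move=> i; exact: (H4 i).1.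
  apply: (@le_trans _ _ (\sum_(i < n) B * delta ^+ 4)).
    apply: ler_sum => i _; apply: (le_trans (H4 i).2).
    by rewrite exprMn -exprM mulrA.
  by rewrite sumr_const card_ord -[leLHS]mulr_natl mulrA.
split=> // k k4.
have ZD w : Z w ^+ k * delta ^+ (4 - k) <= D w.
  apply: (@le_trans _ _ (Z w ^+ 4)).
    rewrite -[in leRHS](subnKC k4) exprD ler_wpM2l ?exprn_ge0 ?(ltW (Z0 w))//.
    by rewrite lerXn2r ?nnegrE ?(ltW d0) ?(ltW (Z0 w)).
  apply: (le_trans (exprD4_le _ _)); rewrite ler_wpM2l// lerD2r.
  exact: norm_pow4_le.
have dk : 0 < delta ^+ (4 - k) by rewrite exprn_gt0.
have ZD' w : Z w ^+ k <= (delta ^+ (4 - k))^-1 * D w.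
  by rewrite mulrC ler_pdivlMr.
have iZ : intg P (fun w => Z w ^+ k).
  apply: (@intg_le _ _ _ _ _ (fun w => (delta ^+ (4 - k))^-1 * D w)).
  - exact: measurable_funX.
  - by move=> w; rewrite ger0_norm// exprn_ge0// ltW.
  - exact: intgZ.
split=> //; apply: (le_trans (Ex_le iZ (intgZ _ iD) ZD')).
rewrite ExZ// mulrC ler_pdivrMr//. by rewrite -[leRHS]mulrA -exprD subnKC.
Qed.

Lemma small_moments_bound d (T : measurableType d) (P : probability T R)
    (Z : T -> R) (C delta : R) k (K : R) (f : T -> R) :
  small_moments P Z C delta -> (k <= 4)%N -> 0 <= K ->
  measurable_fun [set: T] f -> (forall w, `|f w| <= K * Z w ^+ k) ->
  intg P f /\ `|Ex P f| <= K * C * delta ^+ k.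
Proof.
move=> [_ H] /H[iZ EZ] K0 mf fK.
have iKZ := intgZ K iZ.
split; first exact: intg_le mf fK iKZ.
by apply: (le_trans (Ex_norm_le mf iKZ fK)); rewrite ExZ// -mulrA ler_wpM2l.
Qed.

End Scale.

Section TaylorComparison.
Context {R : realType} d d' (T : measurableType d) (T' : measurableType d')
  (P : probability T R) (Q : probability T' R) (n : nat).
Variables (a : T -> 'cV[R]_n) (b : T' -> 'cV[R]_n) (eps : R).

Definition mon (s : seq 'I_n) (y : 'cV[R]_n) : R := \prod_(i <- s) y i 0.

Hypothesis Hmon : forall s, (size s <= 3)%N ->
  [/\ intg P (fun w => mon s (a w)), intg Q (fun w => mon s (b w)) &
    `|Ex P (fun w => mon s (a w)) - Ex Q (fun w => mon s (b w))| <= eps].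

(** The derivative is unrolled one index at a time while [s] collects the coordinates already
    extracted, until an iterated partial at [x] multiplies a monomial covered by [Hmon]. The n^k
    counts the index tuples. *)
Lemma dirderiv_compare k (M : R) (h : 'cV[R]_n -> R) x s : top_bounded k M h ->
  (size s + k <= 3)%N ->
  [/\ intg P (fun w => mon s (a w) * dirderiv k h x (a w)),
      intg Q (fun w => mon s (b w) * dirderiv k h x (b w)) &
    `|Ex P (fun w => mon s (a w) * dirderiv k h x (a w)) -
      Ex Q (fun w => mon s (b w) * dirderiv k h x (b w))| <= n%:R ^+ k * (M * eps)].
Proof.
elim: k h s => [|k IH] h s.
  rewrite addn0 => hM s3; have [ia ib e] := Hmon s3.
  have Ea : (fun w => mon s (a w) * dirderiv 0 h x (a w)) = (fun w => h x * mon s (a w)).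
    by apply/funext => w; rewrite mulrC.
  have Eb : (fun w => mon s (b w) * dirderiv 0 h x (b w)) = (fun w => h x * mon s (b w)).
    by apply/funext => w; rewrite mulrC.
  rewrite Ea Eb; split; try exact: intgZ.
  by rewrite !ExZ// -mulrBr normrM expr0 mul1r ler_pM.
move=> [_ Hh] sk.
have H i := IH (pd i h) (i :: s) (Hh i); rewrite /= addSnnS in H.
have Ea : (fun w => mon s (a w) * dirderiv k.+1 h x (a w)) =
    (fun w => \sum_i mon (i :: s) (a w) * dirderiv k (pd i h) x (a w)).
  apply/funext => w; rewrite mulr_sumr; apply: eq_bigr => i _.
  by rewrite /mon big_cons mulrA [mon _ _ * _]mulrC.
have Eb : (fun w => mon s (b w) * dirderiv k.+1 h x (b w)) =
    (fun w => \sum_i mon (i :: s) (b w) * dirderiv k (pd i h) x (b w)).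
  apply/funext => w; rewrite mulr_sumr; apply: eq_bigr => i _.
  by rewrite /mon big_cons mulrA [mon _ _ * _]mulrC.
have ia i : intg P (fun w => mon (i :: s) (a w) * dirderiv k (pd i h) x (a w)).
  by case: (H i sk).
have ib i : intg Q (fun w => mon (i :: s) (b w) * dirderiv k (pd i h) x (b w)).
  by case: (H i sk).
rewrite Ea Eb; split; try exact: intg_sum.
rewrite !Ex_sum// -sumrB (le_trans (ler_norm_sum _ _ _))//.
apply: (@le_trans _ _ (\sum_(i < n) n%:R ^+ k * (M * eps))).
  by apply: ler_sum => i _; case: (H i sk).
by rewrite sumr_const card_ord -[leLHS]mulr_natl mulrA -exprS.
Qed.

(** The cubic Taylor polynomials at the common point [x] differ in mean only through moments of
    orders 1 to 3, hence through [eps]; fourth moments control the two remainders. *)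
Lemma taylor_compare (M A B : R) (h : 'cV[R]_n -> R) x (Za : T -> R) (Zb : T' -> R) :
  0 <= M -> derivs_bounded 3 M h -> measurable_vec a -> measurable_vec b ->
  (forall w, `|a w| <= Za w) -> intg P (fun w => Za w ^+ 4) ->
  Ex P (fun w => Za w ^+ 4) <= A ->
  (forall w, `|b w| <= Zb w) -> intg Q (fun w => Zb w ^+ 4) ->
  Ex Q (fun w => Zb w ^+ 4) <= B ->
  [/\ intg P (fun w => h (x + a w)), intg Q (fun w => h (x + b w)) &
  `|Ex P (fun w => h (x + a w)) - Ex Q (fun w => h (x + b w))| <=
    M * n%:R ^+ 4 * (A + B) + (n%:R + n%:R ^+ 2 + n%:R ^+ 3) * (M * eps)].
Proof.
move=> M0 Hh ma mb aZ iZa EZa bZ iZb EZb.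
have t1 : top_bounded 1 M h by exact: derivs_bounded_top_bounded Hh.
have t2 : top_bounded 2 M h by exact: derivs_bounded_top_bounded Hh.
have t3 : top_bounded 3 M h by exact: derivs_bounded_top_bounded Hh.
have t4 : top_bounded 4 M h by exact: derivs_bounded_top_bounded Hh.
have [i1a i1b e1] := dirderiv_compare x t1 (s := [::]) isT.
have [i2a i2b e2] := dirderiv_compare x t2 (s := [::]) isT.
have [i3a i3b e3] := dirderiv_compare x t3 (s := [::]) isT.
have monE k (y : 'cV[R]_n) : mon [::] y * dirderiv k h x y = dirderiv k h x y.
  by rewrite /mon big_nil mul1r.
have monF k d0 (T0 : measurableType d0) (y : T0 -> 'cV[R]_n) :
    (fun w => mon [::] (y w) * dirderiv k h x (y w)) = (fun w => dirderiv k h x (y w)).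
  by apply/funext => w; exact: monE.
rewrite !monF in i1a i1b e1 i2a i2b e2 i3a i3b e3.
have tE y : taylor_poly 4 h x y =
    h x + dirderiv 1 h x y + 2^-1 * dirderiv 2 h x y + 6^-1 * dirderiv 3 h x y.
  rewrite /taylor_poly !big_ord_recl big_ord0 /= addr0.
  by rewrite -[0`!]/1%N -[(bump 0 0)`!]/1%N -[(bump 0 (bump 0 0))`!]/2%N
    -[(bump 0 (bump 0 (bump 0 0)))`!]/6%N !divr1 !addrA ![_ / _]mulrC.
have ita : intg P (fun w => taylor_poly 4 h x (a w)).
  under eq_fun do rewrite tE.
  apply: intgD; last exact: intgZ.
  by apply: intgD; [apply: intgD => //; exact: intg_cst|exact: intgZ].
have itb : intg Q (fun w => taylor_poly 4 h x (b w)).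
  under eq_fun do rewrite tE.
  apply: intgD; last exact: intgZ.
  by apply: intgD; [apply: intgD => //; exact: intg_cst|exact: intgZ].
have Et d0 (T0 : measurableType d0) (P0 : probability T0 R) (y : T0 -> 'cV[R]_n) :
    intg P0 (fun w => dirderiv 1 h x (y w)) -> intg P0 (fun w => dirderiv 2 h x (y w)) ->
    intg P0 (fun w => dirderiv 3 h x (y w)) ->
    Ex P0 (fun w => taylor_poly 4 h x (y w)) = h x +
    Ex P0 (fun w => dirderiv 1 h x (y w)) + 2^-1 * Ex P0 (fun w => dirderiv 2 h x (y w)) +
    6^-1 * Ex P0 (fun w => dirderiv 3 h x (y w)).
  move=> j1 j2 j3; under [X in Ex _ X]eq_fun do rewrite tE.
  have k1 := intgD (intg_cst P0 (h x)) j1.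
  rewrite (ExD (intgD k1 (intgZ _ j2)) (intgZ _ j3)) (ExD k1 (intgZ _ j2)).
  by rewrite (ExD (intg_cst P0 (h x)) j1) Ex_cst !ExZ.
have ch : continuous h.
  by move=> z; apply: differentiable_continuous; case: Hh.
have chx : continuous (fun z => h (x + z)).
  move=> z; apply: (@continuous_comp _ _ _ (fun z => x + z) h); last exact: ch.
  apply: (@continuousD _ _ _ (cst x) (fun z => z)); first exact: cst_continuous.
  by move=> ?; exact.
have mha := measurable_vec_comp ma chx; have mhb := measurable_vec_comp mb chx.
have rem d0 (T0 : measurableType d0) (P0 : probability T0 R) (y : T0 -> 'cV[R]_n)
    (Z : T0 -> R) (C : R) :
    measurable_fun [set: T0] (fun w => h (x + y w)) ->
    intg P0 (fun w => taylor_poly 4 h x (y w)) ->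
    (forall w, `|y w| <= Z w) -> intg P0 (fun w => Z w ^+ 4) ->
    Ex P0 (fun w => Z w ^+ 4) <= C ->
    intg P0 (fun w => h (x + y w)) /\
    `|Ex P0 (fun w => h (x + y w)) - Ex P0 (fun w => taylor_poly 4 h x (y w))|
      <= M * n%:R ^+ 4 * C.
  move=> mh it yZ iZ EZ.
  have iMZ := intgZ (M * n%:R ^+ 4) iZ.
  have md := measurable_funB mh (intg_measurable it).
  have bd w : `|h (x + y w) - taylor_poly 4 h x (y w)| <= M * n%:R ^+ 4 * Z w ^+ 4.
    apply: (le_trans (taylor _ _ t4)); rewrite -mulrA ler_wpM2l// exprMn ler_wpM2l//.
    by rewrite lerXn2r ?nnegrE ?(le_trans _ (yZ w)).
  have id := intg_le md bd iMZ.
  have ih : intg P0 (fun w => h (x + y w)).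
    have -> : (fun w => h (x + y w)) = (fun w =>
      (h (x + y w) - taylor_poly 4 h x (y w)) + taylor_poly 4 h x (y w)).
      by apply/funext => w; rewrite subrK.
    exact: intgD.
  split=> //; rewrite -ExB//; apply: (le_trans (Ex_norm_le md iMZ bd)).
  by rewrite ExZ// ler_wpM2l// mulr_ge0// exprn_ge0.
have [iha ra] := rem _ _ P a Za A mha ita aZ iZa EZa.
have [ihb rb] := rem _ _ Q b Zb B mhb itb bZ iZb EZb.
split=> //.
have et := Et _ _ P a i1a i2a i3a; have et' := Et _ _ Q b i1b i2b i3b.
rewrite et in ra; rewrite et' in rb.
move: ra rb e1 e2 e3; rewrite expr1 !ler_norml.
move=> /andP[? ?] /andP[? ?] /andP[? ?] /andP[? ?] /andP[? ?].
(* This sign allows the Taylor factors 1/2 and 1/6 to be replaced by 1. *)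
have e0 : 0 <= M * eps.
  rewrite mulr_ge0//; have [_ _] := Hmon (s := [::]) isT; exact: le_trans.
have p2 : 0 <= n%:R ^+ 2 * (M * eps) by rewrite mulr_ge0// exprn_ge0.
have p3 : 0 <= n%:R ^+ 3 * (M * eps) by rewrite mulr_ge0// exprn_ge0.
by apply/andP; split; rewrite [_ * (A + B)]mulrDr !mulrDl; lra.
Qed.

End TaylorComparison.

(** * Moments of a layer applied to a normal vector *)

Section OneLayer.
Context {R : realType}.

Lemma derivs_bounded_continuous m M n (h : 'cV[R]_n -> R) :
  derivs_bounded m M h -> continuous h.
Proof. by move=> [dh _] x; exact: differentiable_continuous. Qed.

Section LayerMoments.
Context d (T : measurableType d) (P : probability T R) (p q : nat).
Variables (U : T -> 'cV[R]_p) (mu : 'cV[R]_p) (S : 'M[R]_p).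
Variables (g : 'cV[R]_p -> 'cV[R]_q) (L C delta : R).
Hypothesis normU : has_normal_law P U mu S.
Hypotheses (L0 : 0 <= L) (C0 : 0 <= C) (d0 : 0 < delta) (d1 : delta <= 1).

Let Z w := `|U w - mu| + delta.

Hypothesis HZ : small_moments P Z C delta.
Hypothesis Hg : forall j, derivs_bounded 3 L (fun x => g x j 0).

Let a w := g (U w) - mean_vec P (g \o U).
(** L p bounds the first-order variation of [g] and L p^2 the second-order remainder; the extra L
    p^2 C pays for subtracting the mean of that remainder. *)
Let K := L * p%:R + L * p%:R ^+ 2 * (1 + C).

(** [l] is the differential of g_j at [mu], [q_] the second-order remainder and [r] its centred
    version. As [l] has mean 0, the centred output [a] is exactly [l] + [r]. *)
Let l j w := dot (\col_i pd i (fun x => g x j 0) mu) (U w - mu).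
Let q_ j w := g (U w) j 0 - g mu j 0 - l j w.
Let r j w := q_ j w - Ex P (q_ j).

Let K0 : 0 <= K.
Proof. by rewrite addr_ge0// ?mulr_ge0// ?exprn_ge0// addr_ge0. Qed.

Let Zd w : delta <= Z w. Proof. by case: HZ. Qed.

Let Z0 w : 0 <= Z w. Proof. exact: le_trans (ltW d0) (Zd w). Qed.

Let xiZ w : `|U w - mu| <= Z w. Proof. by rewrite lerDl ltW. Qed.

Let muE w : mu + (U w - mu) = U w. Proof. by rewrite addrC subrK. Qed.

Let a_coord j w : (g (U w) - mean_vec P (g \o U)) j 0 =
  g (U w) j 0 - mean_vec P (g \o U) j 0.
Proof. by rewrite [LHS]mxE [X in _ + X]mxE. Qed.

Let lE j w : l j w = dirderiv 1 (fun x => g x j 0) mu (U w - mu).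
Proof. by rewrite /l dotE; apply: eq_bigr => i _; rewrite mxE mulrC. Qed.

Let mg j : measurable_fun [set: T] (fun w => g (U w) j 0).
Proof.
have mU : measurable_vec U by case: normU.
apply: (measurable_vec_comp mU (h := fun x => g x j 0)).
exact: derivs_bounded_continuous (Hg j).
Qed.

Let ml j : measurable_fun [set: T] (l j).
Proof. exact: normal_linear_measurable normU _. Qed.

Let mq j : measurable_fun [set: T] (q_ j).
Proof.
apply: measurable_funB; last exact: ml.
by apply: measurable_funB => //; exact: mg.
Qed.

Let g_lip j w : `|g (U w) j 0 - g mu j 0| <= L * p%:R * Z w.
Proof.
have t1 := derivs_bounded_top_bounded (isT : (0 <= 3)%N) (Hg j).
have := taylor mu (U w - mu) t1.
rewrite muE /taylor_poly big_ord_recl big_ord0 /= fact0 divr1 addr0 expr1.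
move=> /le_trans; apply; rewrite -mulrA !ler_wpM2l//.
Qed.

Let q_bound j w : `|q_ j w| <= L * p%:R ^+ 2 * Z w ^+ 2.
Proof.
have t2 := derivs_bounded_top_bounded (isT : (1 <= 3)%N) (Hg j).
have := taylor mu (U w - mu) t2.
rewrite muE (_ : taylor_poly 2 _ _ _ = g mu j 0 + l j w); last first.
  by rewrite lE /taylor_poly !big_ord_recl big_ord0 /= addr0 !divr1.
rewrite opprD addrA.
move=> /le_trans; apply; rewrite -mulrA ler_wpM2l// exprMn ler_wpM2l ?exprn_ge0//.
by rewrite lerXn2r ?nnegrE.
Qed.

Let q_Ex j : intg P (q_ j) /\ `|Ex P (q_ j)| <= L * p%:R ^+ 2 * C * delta ^+ 2.
Proof.
have Lp : 0 <= L * p%:R ^+ 2 by rewrite mulr_ge0// exprn_ge0.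
exact: small_moments_bound HZ (isT : (2 <= 4)%N) Lp (mq j) (q_bound j).
Qed.

Let mean_g j : mean_vec P (g \o U) j 0 = g mu j 0 + Ex P (q_ j).
Proof.
rewrite mean_vecE.
have -> : (fun w => (g \o U) w j 0) = (fun w => g mu j 0 + l j w + q_ j w).
  by apply/funext => w; rewrite /q_ /=; ring.
have il : intg P (l j) := normal_linear_intg normU _.
have i1 := intgD (intg_cst P (g mu j 0)) il.
rewrite (ExD i1 (q_Ex j).1) (ExD (intg_cst P _) il) Ex_cst.
by rewrite (normal_linear_Ex normU) addr0.
Qed.

Let aE j w : a w j 0 = l j w + r j w.
Proof. by rewrite /a a_coord mean_g /r /q_; ring. Qed.

Let l_bound j w : `|l j w| <= K * Z w.
Proof.
apply: (@le_trans _ _ (L * p%:R * Z w)); last first.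
  by rewrite ler_wpM2r// lerDl mulr_ge0 ?mulr_ge0 ?exprn_ge0// addr_ge0.
rewrite /l dotE (le_trans (ler_norm_sum _ _ _))//.
apply: (@le_trans _ _ (\sum_(i < p) L * Z w)).
  apply: ler_sum => i _; rewrite normrM mxE ler_pM//.
    by apply: (Cb_bound _ ((Hg j).2 i)).
  exact: le_trans (norm_coord _ _ _) (xiZ w).
by rewrite sumr_const card_ord -[leLHS]mulr_natl mulrA [L * _]mulrC.
Qed.

Let dZ2 w : delta ^+ 2 <= Z w ^+ 2.
Proof. by rewrite lerXn2r ?nnegrE ?(ltW d0). Qed.

(** Here [delta <= 1] enters: the shift of the mean, of order delta^2, then fits into the
    first-order bound on [a]. *)
Let dZ w : delta ^+ 2 <= Z w.
Proof. by apply: le_trans (Zd w); rewrite expr2 ler_piMl ?(ltW d0). Qed.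

Let r_bound j w : `|r j w| <= K * Z w ^+ 2.
Proof.
apply: (@le_trans _ _ (L * p%:R ^+ 2 * (1 + C) * Z w ^+ 2)); last first.
  by rewrite ler_wpM2r ?exprn_ge0// lerDr mulr_ge0.
apply: (le_trans (ler_normB _ _)); rewrite mulrDr mulr1 mulrDl lerD ?q_bound//.
apply: (le_trans (q_Ex j).2); rewrite ler_wpM2l// mulr_ge0// mulr_ge0//.
Qed.

Lemma layer_bound j w : `|(g (U w) - mean_vec P (g \o U)) j 0| <= K * Z w.
Proof.
rewrite a_coord mean_g opprD addrA; apply: (le_trans (ler_normB _ _)).
have -> : K * Z w = L * p%:R * Z w + L * p%:R ^+ 2 * (1 + C) * Z w by rewrite mulrDl.
have Lp : 0 <= L * p%:R ^+ 2 by rewrite mulr_ge0// exprn_ge0.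
apply: lerD; first exact: g_lip.
apply: (le_trans (q_Ex j).2); rewrite ler_pM ?sqr_ge0 ?mulr_ge0//.
by rewrite ler_wpM2l// lerDr.
Qed.

Lemma layer_measurable : measurable_vec (fun w => g (U w) - mean_vec P (g \o U)).
Proof.
move=> j; under eq_fun do rewrite a_coord.
by apply: measurable_funD => //; exact: mg.
Qed.

Lemma layer_Ex j : intg P (fun w => (g (U w) - mean_vec P (g \o U)) j 0) /\
  Ex P (fun w => (g (U w) - mean_vec P (g \o U)) j 0) = 0.
Proof.
have il : intg P (l j) := normal_linear_intg normU _.
have ir := intgB (q_Ex j).1 (intg_cst P (Ex P (q_ j))).
have -> : (fun w => (g (U w) - mean_vec P (g \o U)) j 0) = (fun w => l j w + r j w).
  by apply/funext => w; exact: aE.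
split; first exact: intgD.
rewrite (ExD il ir) (ExB (q_Ex j).1 (intg_cst P _)) Ex_cst subrr addr0.
exact: normal_linear_Ex normU _.
Qed.

Let ma j : measurable_fun [set: T] (fun w => a w j 0) := layer_measurable j.

Let mr j : measurable_fun [set: T] (r j).
Proof. by apply: measurable_funB => //; exact: mq. Qed.

Lemma layer_quadratic i j :
  intg P (fun w => a w i 0 * a w j 0) /\
  `|Ex P (fun w => a w i 0 * a w j 0)| <= K ^+ 2 * C * delta ^+ 2.
Proof.
have K2 : 0 <= K ^+ 2 by rewrite exprn_ge0.
apply: (small_moments_bound HZ (isT : (2 <= 4)%N) K2); first exact: measurable_funM.
by move=> w; rewrite normrM -exprMn expr2 ler_pM//; exact: layer_bound.
Qed.

(* The cubic form in the linear part [l] has mean zero by the symmetry of the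
   normal law, and every remaining term carries a factor [r] of order two. *)
Lemma layer_cubic i j k :
  intg P (fun w => a w i 0 * a w j 0 * a w k 0) /\
  `|Ex P (fun w => a w i 0 * a w j 0 * a w k 0)| <= 3 * K ^+ 3 * C * delta ^+ 4.
Proof.
(* Telescoping, one factor [a] replaced by [l] at a time; its three terms give the constant 3. *)
pose f w := r i w * a w j 0 * a w k 0 + l i w * r j w * a w k 0 + l i w * l j w * r k w.
have mf : measurable_fun [set: T] f.
  by do !apply: measurable_funD; do !apply: measurable_funM => //.
have bf w : `|f w| <= 3 * K ^+ 3 * Z w ^+ 4.
  have t1 : `|r i w * a w j 0 * a w k 0| <= K * Z w ^+ 2 * (K * Z w) * (K * Z w).
    by rewrite !normrM !ler_pM ?mulr_ge0//; exact: layer_bound.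
  have t2 : `|l i w * r j w * a w k 0| <= K * Z w * (K * Z w ^+ 2) * (K * Z w).
    by rewrite !normrM !ler_pM ?mulr_ge0//; exact: layer_bound.
  have t3 : `|l i w * l j w * r k w| <= K * Z w * (K * Z w) * (K * Z w ^+ 2).
    by rewrite !normrM !ler_pM ?mulr_ge0.
  apply: (le_trans (ler_normD _ _)); apply: (le_trans (lerD (ler_normD _ _) (lexx _))).
  apply: (le_trans (lerD (lerD t1 t2) t3)).
  by rewrite le_eqVlt; apply/orP; left; apply/eqP; ring.
have K3 : 0 <= 3 * K ^+ 3 by rewrite mulr_ge0// exprn_ge0.
have [jf Ef] := small_moments_bound HZ (isT : (4 <= 4)%N) K3 mf bf.
have [il El] := normal_cubic normU (\col_x pd x (fun x => g x i 0) mu)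
  (\col_x pd x (fun x => g x j 0) mu) (\col_x pd x (fun x => g x k 0) mu).
have -> : (fun w => a w i 0 * a w j 0 * a w k 0) =
    (fun w => l i w * l j w * l k w + f w).
  apply/funext => w; rewrite /f (aE i) (aE j) (aE k).
  by move: (l i w) (l j w) (l k w) (r i w) (r j w) (r k w) => *; ring.
split; first exact: intgD il jf.
by rewrite (ExD il jf) El add0r.
Qed.

End LayerMoments.

End OneLayer.

(** * Propagation through the network *)

Section MomentMatching.
Context {R : realType}.

(** [h] is Lipschitz, so a first moment suffices. Integrability makes the extended-real expectations
    in [d4] finite, so that their difference can be estimated. *)
Lemma normal_intg d (T : measurableType d) (P : probability T R) n
    (U : T -> 'cV[R]_n) m S M (h : 'cV[R]_n -> R) :
  has_normal_law P U m S -> derivs_bounded 3 M h -> intg P (fun w => h (U w)).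
Proof.
move=> hU Hh; have [C C0 HC] := @normal_small_moments R n (\sum_i `|S i i|).
have HZ := HC _ _ _ _ _ _ 1 hU ltr01.
have [//|Zd Zk] := HZ.
  move=> i; rewrite expr1n mulr1 (le_trans (ler_norm _))// (bigD1 i)//=.
  by rewrite lerDl sumr_ge0.
have [i1 _] := Zk 1%N isT.
have mU : measurable_vec U by case: hU.
have mh := measurable_vec_comp mU (derivs_bounded_continuous Hh).
have t1 := derivs_bounded_top_bounded (isT : (0 <= 3)%N) Hh.
have iD : intg P (fun w => h (U w) - h m).
  apply: (intg_le _ _ (intgZ (`|M| * n%:R) i1)); first exact: measurable_funB.
  move=> w; have := taylor m (U w - m) t1.
  rewrite [m + _]addrC subrK /taylor_poly big_ord_recl big_ord0 /= fact0 divr1 addr0 !expr1.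
  move=> /le_trans; apply; apply: (@le_trans _ _ (`|M| * (n%:R * `|U w - m|))).
    by rewrite ler_wpM2r ?mulr_ge0// ler_norm.
  by rewrite -mulrA !ler_wpM2l// lerDl.
have -> : (fun w => h (U w)) = (fun w => (h (U w) - h m) + h m).
  by apply/funext => w; rewrite subrK.
by apply: intgD => //; exact: intg_cst.
Qed.

(** One step of the recursion: the covariance bound makes [V] admissible as the input of the next
    layer. *)
Lemma moment_matching_layer (p q : nat) (K0 L M : R) : 0 <= L -> 0 <= M ->
  exists K : R, forall d d' (T : measurableType d) (T' : measurableType d')
    (P : probability T R) (Q : probability T' R)
    (U : T -> 'cV[R]_p) (V : T' -> 'cV[R]_q) (g : 'cV[R]_p -> 'cV[R]_q)
    mu S (delta : R),
  has_normal_law P U mu S -> 0 < delta <= 1 ->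
  (forall i, S i i <= K0 * delta ^+ 2) ->
  (forall j, derivs_bounded 3 L (fun x => g x j 0)) ->
  moment_matched P Q (g \o U) V ->
  (forall i, cov_mx P (g \o U) i i <= K * delta ^+ 2) /\
  forall h, derivs_bounded 3 M h ->
    `|Ex P (fun w => h (g (U w))) - Ex Q (fun w => h (V w))| <= K * delta ^+ 4.
Proof.
move=> L0 M0.
have [C C0 HC] := @normal_small_moments R p K0.
pose K := L * p%:R + L * p%:R ^+ 2 * (1 + C).
have K_ge0 : 0 <= K by rewrite addr_ge0// ?mulr_ge0// ?exprn_ge0// addr_ge0.
pose K1 := K ^+ 2 * C.
have [C' C'0 HC'] := @normal_small_moments R q K1.
(* The bound of [taylor_compare], with fourth moments K^4 C delta^4 for the layer and C' delta^4 for
   [V], and with [eps] = 3 K^3 C delta^4 from [layer_cubic]. *)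
pose K2 := M * q%:R ^+ 4 * (K ^+ 4 * C + C') +
  (q%:R + q%:R ^+ 2 + q%:R ^+ 3) * (M * (3 * K ^+ 3 * C)).
exists (Num.max K1 K2) => d d' T T' P Q U V g mu S delta hU /andP[d0 d1] HS Hg hV.
have HZ := HC _ _ _ _ _ _ _ hU d0 HS.
have ab := layer_bound hU L0 C0 d0 d1 HZ Hg.
have am := layer_measurable hU Hg.
have a1 := layer_Ex hU L0 d0 HZ Hg.
have a2 := layer_quadratic hU L0 C0 d0 d1 HZ Hg.
have a3 := layer_cubic hU L0 C0 d0 d1 HZ Hg.
rewrite -/K in ab a2 a3.
set m := mean_vec P (g \o U) in ab am a1 a2 a3.
set Z := (fun w => `|U w - mu| + delta) in HZ.
have covE i j : cov_mx P (g \o U) i j =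
    Ex P (fun w => (g (U w) - m) i 0 * (g (U w) - m) j 0) by exact: cov_mxE.
have covK i : cov_mx P (g \o U) i i <= K1 * delta ^+ 2.
  by rewrite covE (le_trans (ler_norm _))//; exact: (a2 i i).2.
split.
  move=> i; apply: (le_trans (covK i)); rewrite ler_wpM2r ?sqr_ge0//.
  by rewrite le_max lexx.
move=> h Hh.
have hV' : has_normal_law Q V m (cov_mx P (g \o U)) := hV.
have HW := HC' _ _ _ _ _ _ _ hV' d0 covK.
have mV : measurable_vec (fun w => V w - m).
  move=> i; under eq_fun do rewrite -(dot_delta i).
  exact: normal_linear_measurable hV' _.
have eps0 : 0 <= 3 * K ^+ 3 * C * delta ^+ 4.
  by rewrite mulr_ge0 ?exprn_ge0 ?(ltW d0)// mulr_ge0// mulr_ge0// exprn_ge0.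
have Hmon (s : seq 'I_q) : (size s <= 3)%N ->
  [/\ intg P (fun w => mon s (g (U w) - m)), intg Q (fun w => mon s (V w - m)) &
    `|Ex P (fun w => mon s (g (U w) - m)) - Ex Q (fun w => mon s (V w - m))| <=
      3 * K ^+ 3 * C * delta ^+ 4].
  have mon0 X (y : X -> 'cV[R]_q) : (fun w => mon [::] (y w)) = fun=> 1.
    by apply/funext => w; rewrite /mon big_nil.
  have mon1 X (y : X -> 'cV[R]_q) i :
      (fun w => mon [:: i] (y w)) = fun w => y w i 0.
    by apply/funext => w; rewrite /mon big_seq1.
  have mon2 X (y : X -> 'cV[R]_q) i j :
      (fun w => mon [:: i; j] (y w)) = fun w => y w i 0 * y w j 0.
    by apply/funext => w; rewrite /mon !big_cons big_nil mulr1.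
  have mon3 X (y : X -> 'cV[R]_q) i j k :
      (fun w => mon [:: i; j; k] (y w)) = fun w => y w i 0 * y w j 0 * y w k 0.
    by apply/funext => w; rewrite /mon !big_cons big_nil mulr1 mulrA.
  case: s => [|i [|j [|k [|//]]]] _.
  - rewrite !mon0.
    by rewrite !Ex_cst subrr normr0; split=> //; exact: intg_cst.
  - rewrite !mon1.
    have EV : (fun w => (V w - m) i 0) = (fun w => dot (delta_mx i 0) (V w - m)).
      by apply/funext => w; rewrite dot_delta.
    rewrite (a1 i).2 EV (normal_linear_Ex hV') subrr normr0; split => //.
      exact: (a1 i).1.
    exact: normal_linear_intg hV' _.
  - rewrite !mon2.
    have [iV EV] := normal_cov_Ex i j hV'.
    by rewrite EV -covE subrr normr0; split=> //; exact: (a2 i j).1.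
  - rewrite !mon3.
    have [iV EV] := normal_cubic hV' (delta_mx i 0) (delta_mx j 0) (delta_mx k 0).
    have E : (fun w => (V w - m) i 0 * (V w - m) j 0 * (V w - m) k 0) =
      (fun w => dot (delta_mx i 0) (V w - m) * dot (delta_mx j 0) (V w - m) *
        dot (delta_mx k 0) (V w - m)).
      by apply/funext => w; rewrite !dot_delta.
    by rewrite E EV subr0; split=> //; [exact: (a3 i j k).1|exact: (a3 i j k).2].
have [Zd Zk] := HZ; have [Wd Wk] := HW.
have Z0 w : 0 <= Z w by apply: le_trans (Zd w); exact: ltW.
have aZ w : `|g (U w) - m| <= K * Z w.
  by apply: norm_coords_le; [rewrite mulr_ge0|move=> i; exact: ab].
have ZE : (fun w => (K * Z w) ^+ 4) = (fun w => K ^+ 4 * Z w ^+ 4).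
  by apply/funext => w; rewrite exprMn.
have iZ : intg P (fun w => (K * Z w) ^+ 4) by rewrite ZE; apply: intgZ; exact: (Zk 4%N isT).1.
have EZ : Ex P (fun w => (K * Z w) ^+ 4) <= K ^+ 4 * C * delta ^+ 4.
  rewrite ZE ExZ; last exact: (Zk 4%N isT).1.
  by rewrite -mulrA ler_wpM2l ?exprn_ge0//; exact: (Zk 4%N isT).2.
have bW w : `|V w - m| <= `|V w - m| + delta by rewrite lerDl ltW.
have [_ _] := taylor_compare Hmon m M0 Hh am mV aZ iZ EZ bW (Wk 4%N isT).1 (Wk 4%N isT).2.
have mK (y : 'cV[R]_q) : m + (y - m) = y by rewrite addrC subrK.
under [X in Ex P X]eq_fun do rewrite mK; under [X in Ex Q X]eq_fun do rewrite mK.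
move=> /le_trans; apply; apply: (@le_trans _ _ (K2 * delta ^+ 4)).
  by rewrite le_eqVlt; apply/orP; left; apply/eqP; rewrite /K2; ring.
by rewrite ler_wpM2r ?exprn_ge0 ?(ltW d0)// le_max lexx orbT.
Qed.

(** This serves the integrability of [h] on the true output; the size of [M'] does not enter the
    rate. *)
Lemma forward_derivs_bounded (n : nat -> nat)
    (g : forall k, 'cV[R]_(n k.-1) -> 'cV[R]_(n k)) k M :
  (forall k, exists L, forall j, derivs_bounded 3 L (fun x => g k x j 0)) ->
  exists M', forall h : 'cV[R]_(n k) -> R, derivs_bounded 3 M h ->
    derivs_bounded 3 M' (h \o forward g k).
Proof.
move=> Hg; elim: k M => [|k IH] M; first by exists M.
have [L HL] := Hg k.+1.
have [M1 H1] := @derivs_bounded_comp R 3 (n k) (n k.+1) L M.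
have [M' H'] := IH M1; exists M' => h Hh.
exact: H' (H1 h (g k.+1) HL Hh).
Qed.

End MomentMatching.

(** * Induction over the layers *)

Unset Implicit Arguments.
Set Strict Implicit.

Theorem theorem4p3 (R : realType) (sigma : R -> R)
  (hsigma : activation_C4b sigma)
  (* the network: parameters at index k >= 1 describe the k-th layer *)
  (ell : nat) (n : nat -> nat)
  (n_gt0 : forall k, (k <= ell)%N -> (0 < n k)%N)
  (A C : forall k, 'M[R]_(n k, n k.-1)) (b c : forall k, 'cV[R]_(n k))
  (g : forall k, 'cV[R]_(n k.-1) -> 'cV[R]_(n k))
  (hg : forall k x, g k x = layer sigma (A k) (b k) (C k) (c k) x)
  (* the k-th moment-matched variable for the input X_lambda lives on its own
     probability space (Om lambda k, P lambda k) *)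
  (disp : measure_display) (Om : R -> nat -> measurableType disp)
  (P : forall (lambda : R) (k : nat), probability (Om lambda k) R)
  (X : forall lambda : R, Om lambda 0%N -> 'cV[R]_(n 0%N))
  (hX : forall lambda : R, 0 < lambda -> gaussian_vec (P lambda 0%N) (X lambda))
  (hcov : exists K : R, \forall lambda \near +oo_R,
     `|cov_mx (P lambda 0%N) (X lambda)| <= K * lambda ^- 2)
  (Y : forall (lambda : R) (k : nat), Om lambda k -> 'cV[R]_(n k))
  (hY0 : forall lambda : R, 0 < lambda -> Y lambda 0%N = X lambda)
  (hY : forall lambda : R, 0 < lambda -> forall k, (1 <= k <= ell)%N ->
     moment_matched (P lambda k.-1) (P lambda k)
       (g k \o Y lambda k.-1) (Y lambda k)) :
  forall k, (1 <= k <= ell)%N ->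
    exists K : R, \forall lambda \near +oo_R,
      (d4 (P lambda 0%N) (P lambda k) (forward g k \o X lambda) (Y lambda k)
         <= (K * lambda ^- 4)%:E)%E.
Proof.
have Hg k : exists L, forall j, derivs_bounded 3 L (fun x => g k x j 0).
  have [L HL] := layer_derivs_bounded (A k) (C k) (b k) (c k) hsigma.
  exists L => j; rewrite (_ : (fun x => _) =
    fun x => layer sigma (A k) (b k) (C k) (c k) x j 0)//.
  by apply/funext => x; rewrite hg.
(* From 1 on, [delta] = 1 / [lambda] is an admissible scale in (0, 1]. *)
have lam1 : \forall lambda \near +oo_R, (1 : R) <= lambda.
  exact: nbhs_pinfty_ge.
have inv2 (l : R) : (l^-1) ^+ 2 = l ^- 2 by rewrite exprVn.
(* The comparison is stated for every [M] because layer [k] + 1 uses it for [h \o g k.+1], which has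
   another derivative bound. The range of [lambda] precedes [h], so one threshold serves the whole
   supremum. *)
pose inv k :=
  (exists K : R, \forall lambda \near +oo_R, exists m S,
    has_normal_law (P lambda k) (Y lambda k) m S /\
    forall i, S i i <= K * lambda ^- 2) /\
  forall M : R, 0 <= M -> exists K : R, \forall lambda \near +oo_R,
    forall h, derivs_bounded 3 M h ->
    `|Ex (P lambda 0%N) (fun w => h (forward g k (X lambda w))) -
      Ex (P lambda k) (fun w => h (Y lambda k w))| <= K * lambda ^- 4.
have Hinv k : (k <= ell)%N -> inv k.
  elim: k => [_|k IH kl].
    split.
      have [K HK] := hcov; exists K; apply: filterS2 lam1 HK => l l1 HK.
      have l0 : 0 < l by exact: lt_le_trans l1.
      have [m [S hS]] := hX l l0; exists m, S; rewrite hY0//; split=> // i.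
      rewrite -(normal_cov hS); apply: le_trans HK.
      by apply: le_trans (norm_coord _ _ _); exact: ler_norm.
    move=> M _; exists 0; apply: filterS lam1 => l l1 h _.
    have l0 : 0 < l by exact: lt_le_trans l1.
    by rewrite hY0// subrr normr0 mul0r.
  have [[K0 HK0] Hcmp] := IH (ltnW kl).
  have [L HL] := Hg k.+1.
  have HL' j : derivs_bounded 3 `|L| (fun x => g k.+1 x j 0).
    exact: derivs_bounded_mono (ler_norm _) (HL j).
  split.
    (* Only the covariance half is used, so the derivative bound is set to 0. *)
    have [K1 HK1] := @moment_matching_layer R (n k) (n k.+1) K0 `|L| 0
      (normr_ge0 _) (lexx _).
    exists K1; apply: filterS2 lam1 HK0 => l l1 [m [S [hS HS]]].
    have l0 : 0 < l by exact: lt_le_trans l1.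
    have hk : (1 <= k.+1 <= ell)%N by [].
    have dl : 0 < l^-1 <= 1 by rewrite invr_gt0 l0 invf_le1.
    have HS' i : S i i <= K0 * l^-1 ^+ 2 by rewrite inv2.
    have [H _] := HK1 _ _ _ _ _ _ _ _ (g k.+1) _ _ _ hS dl HS' HL' (hY l l0 k.+1 hk).
    exists (mean_vec (P l k) (g k.+1 \o Y l k)), (cov_mx (P l k) (g k.+1 \o Y l k)).
    split; first exact: (hY l l0 k.+1 hk).
    by move=> i; have := H i; rewrite inv2.
  move=> M M0.
  have [M1 HM1] := @derivs_bounded_comp R 3 (n k) (n k.+1) L M.
  (* Triangle inequality through the mean of [h \o g k.+1] at [Y l k]: [K2] is the inherited error
     for that test function, [K1] the error of the new layer. *)
  have [K2 HK2] := Hcmp `|M1| (normr_ge0 _).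
  have [K1 HK1] := @moment_matching_layer R (n k) (n k.+1) K0 `|L| M
      (normr_ge0 _) M0.
  exists (K2 + K1); apply: filterS3 lam1 HK0 HK2 => l l1 [m [S [hS HS]]] HK2 h Hh.
  have l0 : 0 < l by exact: lt_le_trans l1.
  have hk : (1 <= k.+1 <= ell)%N by [].
  have dl : 0 < l^-1 <= 1 by rewrite invr_gt0 l0 invf_le1.
  have HS' i : S i i <= K0 * l^-1 ^+ 2 by rewrite inv2.
  have [_ /(_ h Hh) H] := HK1 _ _ _ _ _ _ _ _ (g k.+1) _ _ _ hS dl HS' HL' (hY l l0 k.+1 hk).
  rewrite exprVn in H.
  have Hhg : derivs_bounded 3 `|M1| (h \o g k.+1).
    exact: derivs_bounded_mono (ler_norm _) (HM1 h (g k.+1) HL Hh).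
  have H2 := HK2 _ Hhg.
  rewrite mulrDl; apply: le_trans (lerD H2 H).
  by apply: le_trans (ler_normD _ _); rewrite /= addrA subrK.
move=> k /andP[k1 kl].
have [[K0 HK0] Hcmp] := Hinv k kl.
(* Test functions with [W4norm h <= 1] satisfy [derivs_bounded 3 1]. *)
have [K HK] := Hcmp 1 ler01.
have [M' HM'] := @forward_derivs_bounded R n g k 1 Hg.
exists K; apply: filterS3 lam1 HK0 HK => l l1 [m [S [hS HS]]] HK.
have l0 : 0 < l by exact: lt_le_trans l1.
have [m0 [S0 hS0]] := hX l l0.
apply: ge_ereal_sup => _ [h [Ch h1] <-].
have Hh := test_derivs_bounded Ch h1.
have i1 : intg (P l 0%N) (h \o (forward g k \o X l)).
  exact: (normal_intg hS0 (HM' h Hh)).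
have i2 : intg (P l k) (h \o Y l k) by exact: (normal_intg hS Hh).
rewrite (expectation_Ex i1) (expectation_Ex i2) -EFinB /= lee_fin.
exact: HK.
Qed.
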